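(* Let $X$ be a non-empty set. The word problem for $\mathsf{FFR}(X)$ (given terms $u,v\in\mathbb{T}(X)$, decide whether $u$ and $v$ have the same value in $\mathsf{FFR}(X)$) is decidable with an algorithm of time complexity $O(n^3)$, where $n=\max\{\mathsf{c}(u),\mathsf{c}(v)\}$ and $u,v\in\mathbb{T}(X)$ are the input terms.
   Context: A restriction semigroup is an algebra $(R;\cdot,{}^+)$ of type $(2,1)$ such that $(R;\cdot)$ is a semigroup and the identities $x^+x=x$, $x^+y^+=y^+x^+$, $(x^+y)^+=x^+y^+$, $xy^+=(xy)^+x$ hold. Its set of projections is $P(R)=\{s^+ : s\in R\}$. The natural partial order is $s\le t$ iff $s=et$ for some $e\in P(R)$. The congruence $\sigma$ is given by $s\mathrel{\sigma}t$ iff $es=et$ for some $e\in P(R)$. An $F$-restriction semigroup is a restriction semigroup in which every $\sigma$-class has a maximum element with respect to $\le$; the maximum element of the $\sigma$-class of $s$ is denoted $s^{\mathfrak{m}}$. It has a maximum projection, denoted $\lambda$, which is its unique left identity. $F$-restriction semigroups are regarded as algebras in the signature $(\cdot,{}^+,{}^{\mathfrak{m}},\lambda)$ of type $(2,1,1,0)$; they form a variety, and $\mathsf{FFR}(X)$ denotes the free $X$-generated object of this variety. $\mathbb{T}(X)$ is the absolutely free $X$-generated algebra (term algebra) in the signature $(\cdot,{}^+,{}^{\mathfrak{m}},\lambda)$; the value of a term in $\mathsf{FFR}(X)$ is its image under the canonical morphism $\mathbb{T}(X)\to\mathsf{FFR}(X)$ which is identical on $X$. The complexity $\mathsf{c}(u)$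 of a term $u$ is defined recursively: elements of $X$ and the constant $\lambda$ have complexity $1$; $\mathsf{c}(u\cdot v)=\mathsf{c}(u)+\mathsf{c}(v)+1$; $\mathsf{c}(u^{\mathfrak{m}})=\mathsf{c}(u^+)=\mathsf{c}(u)+1$. *)

(* Defs.v *)
From HB Require Import structures.
From mathcomp Require Import all_boot.
From mathcomp Require Import boolp.

Set Implicit Arguments.
Unset Strict Implicit.
Unset Printing Implicit Defensive.

Record restriction_semigroup := RestrictionSemigroup {
  rs_sort :> Type;
  rs_mul : rs_sort -> rs_sort -> rs_sort;
  rs_plus : rs_sort -> rs_sort;
  rs_mulA : forall x y z, rs_mul x (rs_mul y z) = rs_mul (rs_mul x y) z;
  rs_plus_mul : forall x, rs_mul (rs_plus x) x = x;
  rs_plusC : forall x y,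
    rs_mul (rs_plus x) (rs_plus y) = rs_mul (rs_plus y) (rs_plus x);
  rs_plusM : forall x y,
    rs_plus (rs_mul (rs_plus x) y) = rs_mul (rs_plus x) (rs_plus y);
  rs_mul_plus : forall x y,
    rs_mul x (rs_plus y) = rs_mul (rs_plus (rs_mul x y)) x
}.

Declare Scope restriction_scope.
Delimit Scope restriction_scope with rs.
Local Open Scope restriction_scope.

Notation "x * y" := (rs_mul x y) : restriction_scope.

Definition projection (R : restriction_semigroup) (e : R) : Prop :=
  exists s : R, e = rs_plus s.

Definition natural_le (R : restriction_semigroup) (s t : R) : Prop :=
  exists2 e : R, projection e & s = e * t.

Definition sigma (R : restriction_semigroup) (s t : R) : Prop :=
  exists2 e : R, projection e & e * s = e * t.

Definition sigma_class_max (R : restriction_semigroup) (s m : R) : Prop :=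
  sigma s m /\ forall t : R, sigma s t -> natural_le t m.

Definition max_projection (R : restriction_semigroup) (l : R) : Prop :=
  projection l /\ forall e : R, projection e -> natural_le e l.

Record F_restriction_semigroup := FRestrictionSemigroup {
  frs_base :> restriction_semigroup;
  frs_max : frs_base -> frs_base;
  frs_lam : frs_base;
  frs_maxP : forall s : frs_base, sigma_class_max s (frs_max s);
  frs_lamP : max_projection frs_lam
}.

Arguments frs_lam : clear implicits.

Definition frs_morphism (R S : F_restriction_semigroup) (h : R -> S) : Prop :=
  [/\ forall x y, h (x * y) = h x * h y,
      forall x, h (rs_plus x) = rs_plus (h x),
      forall x, h (frs_max x) = frs_max (h x)
    & h (frs_lam R) = frs_lam S].

Definition free_on (X : Type) (F : F_restriction_semigroup) (i : X -> F) :
    Prop :=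
  forall (R : F_restriction_semigroup) (f : X -> R),
    exists! h : F -> R, frs_morphism h /\ forall x, h (i x) = f x.

Inductive term (X : Type) : Type :=
| Var of X
| Lam
| Mul of term X & term X
| Plus of term X
| Max of term X.

Arguments Lam {X}.

Fixpoint complexity (X : Type) (u : term X) : nat :=
  match u with
  | Var _ | Lam => 1
  | Mul v w => (complexity v + complexity w + 1)%N
  | Plus v | Max v => (complexity v + 1)%N
  end.

Fixpoint eval (X : Type) (R : F_restriction_semigroup) (f : X -> R)
    (u : term X) : R :=
  match u with
  | Var x => f x
  | Lam => frs_lam R
  | Mul v w => eval f v * eval f w
  | Plus v => rs_plus (eval f v)
  | Max v => frs_max (eval f v)
  end.

(* The free object is built below as the quotient of the term algebra by the
   identities valid in all F-restriction semigroups; [FFR_free] is its universal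
   property. *)

Definition valid_identity (X : Type) (u v : term X) : Prop :=
  forall (R : F_restriction_semigroup) (f : X -> R), eval f u = eval f v.

Section RestrictionTheory.
Variable R : restriction_semigroup.
Implicit Types s t : R.

Lemma rs_plus_idem s : rs_plus s * rs_plus s = rs_plus s.
Proof. by rewrite -rs_plusM rs_plus_mul. Qed.

Lemma rs_plus_plus s : rs_plus (rs_plus s) = rs_plus s.
Proof.
by rewrite -[in LHS](rs_plus_idem s) rs_plusM rs_plusC rs_plus_mul.
Qed.

Lemma natural_leE s t : natural_le s t <-> s = rs_plus s * t.
Proof.
split=> [[_ [a ->] ->]|->]; last by exists (rs_plus s) => //; exists s.
by rewrite rs_plusM -rs_mulA rs_plus_mul.
Qed.

End RestrictionTheory.

Lemma frs_max_ge (R : F_restriction_semigroup) (s : R) :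
  s = rs_plus s * frs_max s.
Proof.
apply/natural_leE; have [_] := frs_maxP s; apply.
by exists (rs_plus s) => //; exists s.
Qed.

Section FreeObject.
Variable X : Type.

HB.instance Definition _ := gen_eqMixin (term X).
HB.instance Definition _ := gen_choiceMixin (term X).

Definition identity_rel : rel (term X) := fun u v => `[< valid_identity u v >].

Lemma identity_refl : reflexive identity_rel.
Proof. by move=> u; apply/asboolP. Qed.

Lemma identity_sym : symmetric identity_rel.
Proof. by move=> u v; apply/asboolP/asboolP => uv R f; rewrite uv. Qed.

Lemma identity_trans : transitive identity_rel.
Proof.
by move=> v u w /asboolP uv /asboolP vw; apply/asboolP => R f; rewrite uv.
Qed.

Canonical identity_equiv :=
  EquivRel identity_rel identity_refl identity_sym identity_trans.

Definition FFR_sort : Type := {eq_quot identity_equiv}%qT.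

Local Notation cls := (\pi_{eq_quot identity_equiv}%qT : term X -> FFR_sort).

Lemma clsP u v : cls u = cls v <-> valid_identity u v.
Proof.
split=> [/eqmodP/asboolP //|uv].
by apply/eqmodP/asboolP.
Qed.

Lemma cls_surj (a : FFR_sort) : exists u, a = cls u.
Proof. by exists (repr a); rewrite reprK. Qed.

Lemma identity_repr u : valid_identity (repr (cls u)) u.
Proof. by apply/clsP; rewrite reprK. Qed.

Definition FFR_mul (a b : FFR_sort) : FFR_sort := cls (Mul (repr a) (repr b)).
Definition FFR_plus (a : FFR_sort) : FFR_sort := cls (Plus (repr a)).
Definition FFR_max (a : FFR_sort) : FFR_sort := cls (Max (repr a)).
Definition FFR_lam : FFR_sort := cls Lam.

Lemma FFR_mulE u v : FFR_mul (cls u) (cls v) = cls (Mul u v).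
Proof. by apply/clsP => R f /=; rewrite !identity_repr. Qed.

Lemma FFR_plusE u : FFR_plus (cls u) = cls (Plus u).
Proof. by apply/clsP => R f /=; rewrite !identity_repr. Qed.

Lemma FFR_maxE u : FFR_max (cls u) = cls (Max u).
Proof. by apply/clsP => R f /=; rewrite !identity_repr. Qed.

Definition FFRE := (FFR_mulE, FFR_plusE, FFR_maxE).

Lemma FFR_mulA a b c : FFR_mul a (FFR_mul b c) = FFR_mul (FFR_mul a b) c.
Proof.
have [u ->] := cls_surj a; have [v ->] := cls_surj b.
have [w ->] := cls_surj c; rewrite !FFRE; apply/clsP => R f /=.
exact: rs_mulA.
Qed.

Lemma FFR_plus_mul a : FFR_mul (FFR_plus a) a = a.
Proof.
have [u ->] := cls_surj a; rewrite !FFRE; apply/clsP => R f /=.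
exact: rs_plus_mul.
Qed.

Lemma FFR_plusC a b :
  FFR_mul (FFR_plus a) (FFR_plus b) = FFR_mul (FFR_plus b) (FFR_plus a).
Proof.
have [u ->] := cls_surj a; have [v ->] := cls_surj b.
rewrite !FFRE; apply/clsP => R f /=; exact: rs_plusC.
Qed.

Lemma FFR_plusM a b :
  FFR_plus (FFR_mul (FFR_plus a) b) = FFR_mul (FFR_plus a) (FFR_plus b).
Proof.
have [u ->] := cls_surj a; have [v ->] := cls_surj b.
rewrite !FFRE; apply/clsP => R f /=; exact: rs_plusM.
Qed.

Lemma FFR_mul_plus a b :
  FFR_mul a (FFR_plus b) = FFR_mul (FFR_plus (FFR_mul a b)) a.
Proof.
have [u ->] := cls_surj a; have [v ->] := cls_surj b.
rewrite !FFRE; apply/clsP => R f /=; exact: rs_mul_plus.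
Qed.

Definition FFR_restriction : restriction_semigroup :=
  RestrictionSemigroup FFR_mulA FFR_plus_mul FFR_plusC FFR_plusM FFR_mul_plus.

Lemma FFR_maxP (a : FFR_restriction) : sigma_class_max a (FFR_max a).
Proof.
have [u ->] := cls_surj a; split.
  exists (FFR_plus (cls u)); first by exists (cls u).
  rewrite /= !FFRE; apply/clsP => R f /=.
  by rewrite !identity_repr rs_plus_mul; exact: frs_max_ge.
move=> b; have [v ->] := cls_surj b => -[_ [c ->]].
have [w ->] := cls_surj c; rewrite /= !FFRE => /clsP uv.
apply/(@natural_leE FFR_restriction); rewrite /= !FFRE.
apply/clsP => R f /=; rewrite !identity_repr; apply/natural_leE; have [_] := frs_maxP (eval f u); apply.
by exists (rs_plus (eval f w)); [exists (eval f w) |]; move: (uv R f) => /=; rewrite !identity_repr.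
Qed.

Lemma FFR_lamP : max_projection (FFR_lam : FFR_restriction).
Proof.
split=> [|_ [c ->]].
  exists FFR_lam; rewrite /FFR_lam /= FFRE; apply/clsP => R f /=.
  by have [[s ->] _] := frs_lamP R; rewrite rs_plus_plus.
have [w ->] := cls_surj c; apply/(@natural_leE FFR_restriction).
rewrite /FFR_lam /= !FFRE; apply/clsP => R f /=.
rewrite ?identity_repr; apply/natural_leE.
by have [_] := frs_lamP R; apply; exists (eval f w).
Qed.

Definition FFR : F_restriction_semigroup :=
  FRestrictionSemigroup FFR_maxP FFR_lamP.

Definition FFR_gen (x : X) : FFR := cls (Var x).

Definition value (u : term X) : FFR := eval FFR_gen u.

Lemma valueE u : value u = cls u.
Proof.
rewrite /value; elim: u => //= [u -> v ->|u ->|u ->].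
- exact: FFR_mulE.
- exact: FFR_plusE.
- exact: FFR_maxE.
Qed.

Theorem FFR_free : free_on FFR_gen.
Proof.
move=> R f; pose h (a : FFR) := eval f (repr a).
have hE u : h (cls u) = eval f u by exact: identity_repr.
exists h; split=> [|g [[gM gP gm gl] gX]].
  split; last by move=> x; exact: hE.
  split=> [a b|a|a|]; last exact: hE.
  - have [u ->] := cls_surj a; have [v ->] := cls_surj b.
    by rewrite [_ * _]FFR_mulE !hE.
  - by have [u ->] := cls_surj a; rewrite [rs_plus _]FFR_plusE !hE.
  - by have [u ->] := cls_surj a; rewrite [frs_max _]FFR_maxE !hE.
apply/funext => a; have [u ->] := cls_surj a; rewrite hE -valueE /value.
by elim: u => //= [u IHu v IHv|u IHu|u IHu];
  rewrite ?gM ?gP ?gm ?IHu ?IHv.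
Qed.

End FreeObject.

(** Random access machines under the uniform cost criterion, programmed in
    structured form.  The input is a read-only word over an alphabet that may
    be infinite; a program can inspect letters only by testing two input
    positions for equality.  The memory consists of registers and of finitely
    many (for each program) arrays of natural numbers, all initially zero; the
    arithmetic operations are addition and truncated subtraction. *)

Inductive operation := OpLam | OpMul | OpPlus | OpMax.

Inductive symbol (X : Type) : Type :=
| Letter of X
| Oper of operation.

Arguments Oper {X}.

Inductive expr : Type :=
| Const of nat
| Reg of nat
| Arr of nat & expr
| Add of expr & expr
| Sub of expr & expr.

Inductive test : Type :=
| Leq of expr & expr
| InputOper of operation & expr
| InputSame of expr & expr
| InputEnd of expr
| Not of test
| And of test & test.

Inductive program : Type :=
| Skip
| SetReg of nat & expr
| SetArr of nat & expr & expr
| Seq of program & program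
| If of test & program & program
| While of test & program.

Record memory := Memory { reg : nat -> nat; arr : nat -> nat -> nat }.

Definition init_memory : memory := Memory (fun=> 0) (fun _ _ => 0).

Definition set_reg (m : memory) (r a : nat) : memory :=
  Memory (fun s => if s == r then a else reg m s) (arr m).

Definition set_arr (m : memory) (r i a : nat) : memory :=
  Memory (reg m)
    (fun s j => if (s == r) && (j == i) then a else arr m s j).

Fixpoint expr_val (m : memory) (e : expr) : nat :=
  match e with
  | Const a => a
  | Reg r => reg m r
  | Arr r e1 => arr m r (expr_val m e1)
  | Add e1 e2 => (expr_val m e1 + expr_val m e2)%N
  | Sub e1 e2 => (expr_val m e1 - expr_val m e2)%N
  end.

Fixpoint expr_cost (e : expr) : nat :=
  match e with
  | Const _ | Reg _ => 1
  | Arr _ e1 => (expr_cost e1).+1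
  | Add e1 e2 | Sub e1 e2 => (expr_cost e1 + expr_cost e2).+1
  end.

(* Reading past the end of the input yields [None]. *)
Fixpoint test_holds (X : Type) (inp : seq (symbol X)) (m : memory) (t : test) :
    Prop :=
  match t with
  | Leq e1 e2 => (expr_val m e1 <= expr_val m e2)%N
  | InputOper o e => onth inp (expr_val m e) = Some (Oper o)
  | InputSame e1 e2 => onth inp (expr_val m e1) = onth inp (expr_val m e2)
  | InputEnd e => onth inp (expr_val m e) = None
  | Not t1 => ~ test_holds inp m t1
  | And t1 t2 => test_holds inp m t1 /\ test_holds inp m t2
  end.

Fixpoint test_cost (t : test) : nat :=
  match t with
  | Leq e1 e2 | InputSame e1 e2 => (expr_cost e1 + expr_cost e2).+1
  | InputOper _ e | InputEnd e => (expr_cost e).+1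
  | Not t1 => (test_cost t1).+1
  | And t1 t2 => (test_cost t1 + test_cost t2).+1
  end.

(* [exec inp p m k m'] : on input [inp], started in memory [m], the program [p]
   halts in memory [m'] after [k] steps. *)
Inductive exec (X : Type) (inp : seq (symbol X)) :
    program -> memory -> nat -> memory -> Prop :=
| ExecSkip m : exec inp Skip m 1 m
| ExecSetReg r e m :
    exec inp (SetReg r e) m (expr_cost e).+1 (set_reg m r (expr_val m e))
| ExecSetArr r e1 e2 m :
    exec inp (SetArr r e1 e2) m (expr_cost e1 + expr_cost e2).+1
      (set_arr m r (expr_val m e1) (expr_val m e2))
| ExecSeq p1 p2 m1 m2 m3 k1 k2 :
    exec inp p1 m1 k1 m2 -> exec inp p2 m2 k2 m3 ->
    exec inp (Seq p1 p2) m1 (k1 + k2)%N m3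
| ExecIfTrue t p1 p2 m m' k :
    test_holds inp m t -> exec inp p1 m k m' ->
    exec inp (If t p1 p2) m (test_cost t + k).+1 m'
| ExecIfFalse t p1 p2 m m' k :
    ~ test_holds inp m t -> exec inp p2 m k m' ->
    exec inp (If t p1 p2) m (test_cost t + k).+1 m'
| ExecWhileTrue t p m1 m2 m3 k1 k2 :
    test_holds inp m1 t -> exec inp p m1 k1 m2 ->
    exec inp (While t p) m2 k2 m3 ->
    exec inp (While t p) m1 (test_cost t + k1 + k2).+1 m3
| ExecWhileFalse t p m :
    ~ test_holds inp m t -> exec inp (While t p) m (test_cost t).+1 m.

Lemma exec_det (X : Type) (inp : seq (symbol X)) p m k1 m1 k2 m2 :
  exec inp p m k1 m1 -> exec inp p m k2 m2 -> k1 = k2 /\ m1 = m2.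
Proof.
move=> H1; elim: H1 k2 m2 => {p m k1 m1}
  [m|r e m|r e1 e2 m|p1 p2 m1 m2 m3 k1 k2 _ IH1 _ IH2
  |t p1 p2 m m' k ht _ IH|t p1 p2 m m' k ht _ IH
  |t p m1 m2 m3 k1 k2 ht _ IH1 _ IH2|t p m ht] k' m'' H;
  inversion H; subst => //;
  repeat match goal with
  | IH : forall k m, exec _ ?p ?m1 k m -> _, E : exec _ ?p ?m1 _ _ |- _ =>
      have [? ?] := IH _ _ E; clear E; subst
  end; by [].
Qed.

(* The answer is left in register 0: 1 for yes, 0 for no. *)
Definition decides_in_time (X A : Type) (input : A -> seq (symbol X))
    (size_of : A -> nat) (P : A -> Prop) (p : program) (T : nat -> nat) : Prop :=
  forall a : A, exists (k : nat) (m : memory),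
    [/\ exec (input a) p init_memory k m,
        (k <= T (size_of a))%N
      & (P a /\ reg m 0 = 1) \/ (~ P a /\ reg m 0 = 0)].

Definition bigO (T g : nat -> nat) : Prop :=
  exists C N : nat, forall n, (N <= n)%N -> (T n <= C * g n)%N.

Definition decidable_in_time_O (X A : Type) (input : A -> seq (symbol X))
    (size_of : A -> nat) (P : A -> Prop) (g : nat -> nat) : Prop :=
  exists (p : program) (T : nat -> nat),
    decides_in_time input size_of P p T /\ bigO T g.

(* Terms are presented to the machine in Polish notation, whose length is
   exactly the complexity of the term; a pair of terms is presented as the
   concatenation, which is uniquely readable. *)
Fixpoint polish (X : Type) (u : term X) : seq (symbol X) :=
  match u with
  | Var x => [:: Letter x]
  | Lam => [:: Oper OpLam]
  | Mul v w => Oper OpMul :: polish v ++ polish w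
  | Plus v => Oper OpPlus :: polish v
  | Max v => Oper OpMax :: polish v
  end.

Lemma size_polish (X : Type) (u : term X) : size (polish u) = complexity u.
Proof.
by elim: u => //= [u IHu v IHv|u IHu|u IHu];
  rewrite ?size_cat ?IHu ?IHv addn1.
Qed.

Definition word_problem_input (X : Type) (uv : term X * term X) :
    seq (symbol X) :=
  polish uv.1 ++ polish uv.2.

Definition word_problem_size (X : Type) (uv : term X * term X) : nat :=
  maxn (complexity uv.1) (complexity uv.2).

Definition same_value (X : Type) (uv : term X * term X) : Prop :=
  value uv.1 = value uv.2.

(* Main.v *)
From HB Require Import structures.
From mathcomp Require Import all_boot zify.
From mathcomp Require Import boolp.
Require Import Defs.

(** An element s of an F-restriction semigroup is the product of the projection
    s^+ and of the greatest element of its sigma-class, so two terms have the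
    same value exactly when these two data agree. The sigma-class is governed by
    a word in the letters: let [content u] be the word read off u when every
    factor under a plus is skipped, and let mu w be the greatest element of the
    class of the word w.

    The projection is governed by a finite set of edges of the prefix tree of
    words. Pushing a prefix mu a through a term turns (mu a * u)^+ into a meet
    of two kinds of elementary projections: (mu a * x)^+ for a letter x that is
    read at the word a, and (mu a * mu c)^+ for a maximum with content c that is
    taken at a ([below_edges]). The first is recorded as a strong edge from a to
    a x, the second as a weak edge from a to a c. What one meet imposes on
    another is captured by few rules. Since
    mu a * mu b = (mu a * mu b)^+ * mu (a b), weak edges compose; since the
    constant is a left identity, an edge leaving a forces the loop at a. The
    loop is not automatic, because the constant is not a right identity. A
    strong edge moreover forces the weak edge with the same ends, since a letter
    lies below the greatest element of its class, and is itself forced by no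
    other edge. So the edges of u determine which edges are implied ([linked],
    [covered]), and equal words together with mutually implied edges give equal
    values ([covered_eval]). Conversely the edge sets closed under these rules, each
    with an end point, form an F-restriction semigroup in which every term has
    its own edges and its own word as value ([eval_pointed]). Together this is
    [same_valueE].

    It remains to decide that criterion. A traversal of the two terms with a
    stack of pending tasks builds a trie of the words that occur, so that words
    become node numbers, and the two lists of edges ([wp_tasks_term]). A letter
    is looked up by scanning all nodes, which keeps this phase quadratic. For
    each edge, the nodes linked to its source are then marked. Nodes are
    numbered so that a prefix comes first ([trie_le]), hence no edge goes back
    and a single sweep over the nodes, scanning the edge list at each of them,
    is enough ([marked_visit], [marked_end]). With linearly many nodes and edges
    this costs a quadratic number of steps per edge, and cubic time in all. *)

Set Implicit Arguments.
Unset Strict Implicit.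
Unset Printing Implicit Defensive.

(** * Words and edges of a term *)

Record edge (X : Type) :=
  Edge { strong : bool; source : seq X; target : seq X }.

HB.instance Definition _ (X : Type) := gen_eqMixin (edge X).

Section EdgesOfTerms.
Variable X : Type.
Implicit Types (a b c : seq X) (u v : term X) (G : seq (edge X)).

Fixpoint content u : seq X :=
  match u with
  | Var x => [:: x]
  | Lam => [::]
  | Mul v w => content v ++ content w
  | Plus _ => [::]
  | Max v => content v
  end.

(** The argument a is the word at which u is read. The loop contributed by the
    constant is what multiplying by it on the right adds. A maximum forgets
    everything about its argument but the word. *)
Fixpoint edges a u : seq (edge X) :=
  match u with
  | Var x => [:: Edge true a (a ++ [:: x])]
  | Lam => [:: Edge false a a]
  | Mul v w => edges a v ++ edges (a ++ content v) w
  | Plus v => edges a v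
  | Max v => [:: Edge false a (a ++ content v)]
  end.

(** Loops are only granted at sources: the end of an edge need not carry one. *)
Inductive linked G : seq X -> seq X -> Prop :=
| linked_edge k a b : Edge k a b \in G -> linked G a b
| linked_refl k a b : Edge k a b \in G -> linked G a a
| linked_trans a b c : linked G a b -> linked G b c -> linked G a c.

Definition covered G H : Prop :=
  forall k a b, Edge k a b \in G ->
    (k -> Edge true a b \in H) /\ linked H a b.

Lemma size_edges a u : size (edges a u) <= complexity u.
Proof.
elim: u a => //= [v IHv w IHw|v IHv|v IHv] a; rewrite ?size_cat.
- by rewrite addn1 leqW // leq_add.
- by rewrite addn1 leqW.
- by rewrite addn1.
Qed.

Lemma edges_target a u k s t :
  Edge k s t \in edges a u -> exists c, t = s ++ c /\ (k -> size c = 1).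
Proof.
elim: u a => [x||v IHv w IHw|v IHv|v IHv] a /=; rewrite ?mem_seq1 ?mem_cat.
- by move=> /eqP[_ -> ->]; exists [:: x].
- by move=> /eqP[-> -> ->]; exists [::]; rewrite cats0.
- by case/orP => [/IHv|/IHw].
- exact: IHv.
- by move=> /eqP[-> -> ->]; exists (content v).
Qed.

Lemma linked_sub G H a b : {subset G <= H} -> linked G a b -> linked H a b.
Proof.
move=> GH; elim=> {a b} [k a b /GH|k a b /GH|a b c _ ab _]; first exact: linked_edge.
  exact: linked_refl.
exact: linked_trans.
Qed.

Lemma edges_shift a b u k s t : Edge k s t \in edges a u ->
  Edge k (b ++ s) (b ++ t) \in edges (b ++ a) u.
Proof.
elim: u a => [x||v IHv w IHw|v IHv|v IHv] a /=; rewrite ?mem_seq1 ?mem_cat.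
- by move=> /eqP[-> -> ->]; rewrite catA.
- by move=> /eqP[-> -> ->].
- by rewrite -catA => /orP[/IHv ->|/IHw ->]; rewrite ?orbT.
- exact: IHv.
- by move=> /eqP[-> -> ->]; rewrite catA.
Qed.

Lemma edges_unshift b u k s t : Edge k s t \in edges b u ->
  exists s' t', [/\ s = b ++ s', t = b ++ t' & Edge k s' t' \in edges [::] u].
Proof.
rewrite -[b in edges b u]cats0; move: [::] => a.
elim: u a k s t => [x||v IHv w IHw|v IHv|v IHv] a k s t /=;
  rewrite ?mem_seq1 ?mem_cat.
- move=> /eqP[-> -> ->]; exists a, (a ++ [:: x]).
  by rewrite mem_head catA.
- by move=> /eqP[-> -> ->]; exists a, a; rewrite mem_head.
- rewrite -catA => /orP[/IHv|/IHw] [s' [t' [-> -> st]]]; exists s', t';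
    by rewrite mem_cat st ?orbT.
- exact: IHv.
- move=> /eqP[-> -> ->]; exists a, (a ++ content v).
  by rewrite mem_head catA.
Qed.

(** Edges of a term never float: each starts at a word that is linked to the
    starting point. This makes [linked] agree with the closure used for the
    semigroup of edge sets, where rootedness is imposed. *)
Lemma edges_rooted a u :
  [/\ linked (edges a u) a a, linked (edges a u) a (a ++ content u)
    & forall k s t, Edge k s t \in edges a u -> linked (edges a u) a s].
Proof.
elim: u a => [x||v IHv w IHw|v IHv|v IHv] a /=; last first.
- split; try by [apply: linked_refl; exact: mem_head
                |apply: linked_edge; exact: mem_head].
  by move=> k s t; rewrite mem_seq1 => /eqP[_ -> _];
    apply: linked_refl; exact: mem_head.
- by have [aa _ src] := IHv a; rewrite cats0.
- have [aa ab srcv] := IHv a; have [bb bc srcw] := IHw (a ++ content v).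
  have subl : {subset edges a v <= edges a v ++ edges (a ++ content v) w}.
    by move=> e; rewrite mem_cat => ->.
  have subr : {subset edges (a ++ content v) w
                      <= edges a v ++ edges (a ++ content v) w}.
    by move=> e; rewrite mem_cat => ->; rewrite orbT.
  split; first exact: linked_sub aa.
    rewrite catA; apply: linked_trans; [exact: linked_sub ab|exact: linked_sub bc].
  move=> k s t; rewrite mem_cat => /orP[/srcv|/srcw] ls.
    exact: linked_sub ls.
  by apply: linked_trans; [exact: linked_sub ab|exact: linked_sub ls].
- rewrite cats0; split; try by apply: linked_refl; exact: mem_head.
  by move=> k s t; rewrite mem_seq1 => /eqP[_ -> _];
    apply: linked_refl; exact: mem_head.
- split; try by [apply: linked_refl; exact: mem_head
                |apply: linked_edge; exact: mem_head].
  by move=> k s t; rewrite mem_seq1 => /eqP[_ -> _];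
    apply: linked_refl; exact: mem_head.
Qed.

Lemma linked_target G a b :
  (forall k s t, Edge k s t \in G -> exists c, t = s ++ c) ->
  linked G a b -> exists c, b = a ++ c.
Proof.
move=> pre; elim=> {a b} [k a b /pre //|k a b _|a b c _ [d ->] _ [e ->]].
  by exists [::]; rewrite cats0.
by exists (d ++ e); rewrite catA.
Qed.

End EdgesOfTerms.

(** * Projections of values are meets of edges *)

Section Evaluation.
Local Open Scope restriction_scope.

Section Projections.
Variable R : restriction_semigroup.
Implicit Types s t x y : R.

Lemma rs_plus_mulr s t : rs_plus (s * rs_plus t) = rs_plus (s * t).
Proof.
by rewrite rs_mul_plus rs_plusM rs_plusC -rs_plusM rs_mulA rs_plus_mul.
Qed.

(** The order of the projections of s and t, phrased for arbitrary elements so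
    that meets of projections appear as plus of products ([below_mul]). *)
Definition below s t := rs_plus s * rs_plus t = rs_plus s.

Lemma below_refl s : below s s.
Proof. exact: rs_plus_idem. Qed.

Lemma below_trans s t x : below s t -> below t x -> below s x.
Proof. by rewrite /below => st tx; rewrite -st -rs_mulA tx. Qed.

Lemma below_anti s t : below s t -> below t s -> rs_plus s = rs_plus t.
Proof. by move=> st ts; rewrite -st rs_plusC ts. Qed.

Lemma below_mul s t x : below s (rs_plus t * x) <-> below s t /\ below s x.
Proof.
rewrite /below rs_plusM; split=> [st|[st sx]]; last by rewrite rs_mulA st.
split; rewrite -st -!rs_mulA.
  by rewrite [rs_plus x * _]rs_plusC (rs_mulA (rs_plus t)) rs_plus_idem.
by rewrite rs_plus_idem.
Qed.

Lemma below_mulr s t : below (s * t) s.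
Proof.
by rewrite /below rs_plusC -rs_plusM rs_mulA rs_plus_mul.
Qed.

Lemma below_mul2l s t x : below t x -> below (s * t) (s * x).
Proof.
move=> tx; have -> : below (s * t) (s * x) <->
    below (s * rs_plus x * rs_plus t) (s * rs_plus x).
  by rewrite /below -rs_mulA [rs_plus x * _]rs_plusC tx !rs_plus_mulr.
exact: below_mulr.
Qed.

Lemma natural_le_below s t : natural_le s t -> below s t.
Proof. by move=> /natural_leE ->; have /below_mul[] := below_refl (rs_plus s * t). Qed.

Lemma projection_mul e g : projection e -> projection g ->
  projection (e * g : R).
Proof. by move=> [s ->] [t ->]; exists (rs_plus s * t); rewrite rs_plusM. Qed.

Lemma projection_comm e g : projection e -> projection g -> e * g = g * e :> R.
Proof. by move=> [s ->] [t ->]; exact: rs_plusC. Qed.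

Lemma sigma_sym s t : sigma s t -> sigma t s.
Proof. by move=> [e pe st]; exists e. Qed.

Lemma sigma_trans s t x : sigma s t -> sigma t x -> sigma s x.
Proof.
move=> [e pe st] [g pg tx]; exists (e * g); first exact: projection_mul.
rewrite {1}(projection_comm pe pg) -!rs_mulA st -tx !rs_mulA.
by rewrite (projection_comm pe pg).
Qed.

Lemma natural_le_sigma s t : natural_le s t -> sigma s t.
Proof.
move=> [_ [x ->] ->]; exists (rs_plus x); first by exists x.
by rewrite rs_mulA rs_plus_idem.
Qed.

Lemma sigma_mul s s' t t' : sigma s s' -> sigma t t' -> sigma (s * t) (s' * t').
Proof.
move=> [e pe ss'] [g [x ->] tt']; apply: (@sigma_trans _ (s' * t)).
  by exists e => //; rewrite !rs_mulA ss'.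
exists (rs_plus (s' * x)); first by exists (s' * x).
by rewrite !rs_mulA -rs_mul_plus -!rs_mulA tt'.
Qed.

Lemma natural_le_anti s t : natural_le s t -> natural_le t s -> s = t.
Proof.
move=> st ts; have eqp := below_anti (natural_le_below st) (natural_le_below ts).
by move/natural_leE: st => ->; rewrite eqp rs_plus_mul.
Qed.

End Projections.

Section MaximumElements.
Variable R : F_restriction_semigroup.
Implicit Types s t : R.
Local Notation lam := (frs_lam R).

Lemma lam_plus : rs_plus lam = lam.
Proof. by have [[r ->] _] := frs_lamP R; exact: rs_plus_plus. Qed.

Lemma plus_lam s : rs_plus s * lam = rs_plus s.
Proof.
have [_ /(_ (rs_plus s)) top] := frs_lamP R.
have /top/natural_leE : projection (rs_plus s) by exists s.
by rewrite rs_plus_plus => <-.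
Qed.

Lemma lam_mul s : lam * s = s.
Proof.
by rewrite -{1}(rs_plus_mul s) -lam_plus rs_mulA rs_plusC lam_plus plus_lam rs_plus_mul.
Qed.

Lemma below_lam s : below s lam.
Proof. by rewrite /below lam_plus plus_lam. Qed.

Lemma max_sigma s t : sigma s t -> frs_max s = frs_max t.
Proof.
move=> st; have [ss ms] := frs_maxP s; have [tt mt] := frs_maxP t.
apply: natural_le_anti; [apply: mt|apply: ms].
  exact: sigma_trans (sigma_sym st) ss.
exact: sigma_trans st tt.
Qed.

Lemma max_lam : frs_max lam = lam.
Proof. by rewrite [RHS]frs_max_ge lam_plus lam_mul. Qed.

End MaximumElements.

Section ValuesAreMeets.
Variables (X : Type) (R : F_restriction_semigroup) (f : X -> R).
Implicit Types (a b c : seq X) (u v : term X) (p : R) (G : seq (edge X)).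
Local Notation lam := (frs_lam R).

(** The trailing constant does not affect the sigma-class, hence not
    [word_max]. *)
Definition word_value a : R := foldr (fun x r => f x * r) lam a.

Definition word_max a : R := frs_max (word_value a).

(** The elementary projection of an edge is the plus of this element. The label
    of the edge is recovered by dropping the source from the target. *)
Definition edge_value (e : edge X) : R :=
  let: Edge k a b := e in
  word_max a * (if k then if drop (size a) b is x :: _ then f x else lam
                else word_max (drop (size a) b)).

Lemma word_value_cat a b : word_value (a ++ b) = word_value a * word_value b.
Proof. by elim: a => /= [|x a ->]; rewrite ?lam_mul // rs_mulA. Qed.

Lemma eval_sigma u : sigma (eval f u) (word_value (content u)).
Proof.
elim: u => [x||v IHv w IHw|v IHv|v IHv] /=.
- apply/sigma_sym/natural_le_sigma/natural_leE.
  by rewrite -[in LHS]lam_plus rs_mul_plus.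
- by exists lam => //; exists lam; rewrite lam_plus.
- by rewrite word_value_cat; exact: sigma_mul.
- apply/natural_le_sigma/natural_leE.
  by rewrite rs_plus_plus plus_lam.
- by apply: sigma_trans IHv; apply/sigma_sym; have [] := frs_maxP (eval f v).
Qed.

Lemma natural_le_word_max s a : sigma s (word_value a) ->
  s = rs_plus s * word_max a.
Proof.
by move=> sa; apply/natural_leE; have [_] := frs_maxP (word_value a);
  apply; exact: sigma_sym.
Qed.

Lemma word_max_nil : word_max [::] = lam.
Proof. exact: max_lam. Qed.

Lemma word_max_sigma a : sigma (word_max a) (word_value a).
Proof. by apply/sigma_sym; have [] := frs_maxP (word_value a). Qed.

(** The source of transitivity: both sides lie in the class of a b. *)
Lemma word_max_mul a b :
  word_max a * word_max b = rs_plus (word_max a * word_max b) * word_max (a ++ b).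
Proof.
apply: natural_le_word_max; rewrite word_value_cat.
by apply: sigma_mul; exact: word_max_sigma.
Qed.

Lemma eval_content u : eval f u = rs_plus (eval f u) * word_max (content u).
Proof. exact/natural_le_word_max/eval_sigma. Qed.

(** In a product v w the prefix mu a passes through v at the price of the meet
    with (mu a * v)^+, after which mu a * mu (content v) can be replaced by the
    greatest element of its class: the projection this needs lies above
    (mu a * v)^+ since v is below mu (content v). *)
Lemma below_edges p a u :
  below p (word_max a * eval f u) <->
  (forall e, e \in edges a u -> below p (edge_value e)).
Proof.
have one e : (forall e', e' \in [:: e] -> below p (edge_value e')) <->
    below p (edge_value e).
  by split=> [|? ?]; [apply; exact: mem_head|rewrite mem_seq1 => /eqP ->].
elim: u a => [x||v IHv w IHw|v IHv|v IHv] a /=; rewrite ?one /=.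
- by rewrite drop_size_cat.
- by rewrite drop_size word_max_nil.
- have -> : (forall e, e \in edges a v ++ edges (a ++ content v) w ->
      below p (edge_value e)) <->
      below p (word_max a * eval f v) /\
      below p (word_max (a ++ content v) * eval f w).
    rewrite IHv IHw; split=> [vw|[bv bw] e]; last first.
      by rewrite mem_cat => /orP[/bv|/bw].
    by split=> e ev; apply: vw; rewrite mem_cat ev ?orbT.
  have -> : word_max a * (eval f v * eval f w) =
      rs_plus (word_max a * eval f v) *
      (rs_plus (word_max a * word_max (content v)) *
       (word_max (a ++ content v) * eval f w)).
    rewrite {1}(eval_content v) !rs_mulA [word_max a * rs_plus _]rs_mul_plus.
    by rewrite -[X in X * _ = _]rs_mulA {1}word_max_mul !rs_mulA.
  rewrite !below_mul; split=> [[? []] //|[pv pw]]; split=> //; split=> //.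
  apply: below_trans pv _; apply: below_mul2l; apply: natural_le_below.
  by apply/natural_leE; exact: eval_content.
- by rewrite -IHv /below rs_plus_mulr.
- by rewrite drop_size_cat //; rewrite (max_sigma (eval_sigma v)).
Qed.

(** Each rule of [linked] is an inequality of elementary projections: a letter is
    below the greatest element of its class, every element is a left multiple of
    the constant, and mu d * mu e is below mu (d e). *)
Lemma below_linked G p a b :
  (forall k s t, Edge k s t \in G ->
     exists c, t = s ++ c /\ (k -> size c = 1)) ->
  (forall e, e \in G -> below p (edge_value e)) ->
  linked G a b -> below p (edge_value (Edge false a b)).
Proof.
move=> pre pG; have pre' k s t : Edge k s t \in G -> exists c, t = s ++ c.
  by move=> /pre[c []]; exists c.
elim=> {a b} [k a b ab|k a b ab|a b c ab IHab bc IHbc].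
- case: k ab => ab; last exact: (pG _ ab).
  have [c [bE sc]] := pre _ _ _ ab; subst b.
  have := pG _ ab; rewrite /= !drop_size_cat // => /below_trans; apply.
  case: c sc {ab} => [|x [|y c]] sc; try by have := sc isT.
  apply/below_mul2l/natural_le_below/natural_leE/natural_le_word_max.
  exact: (eval_sigma (Var x)).
- rewrite /= drop_size word_max_nil; apply: below_trans (pG _ ab) _ => /=.
  by apply: below_mul2l; exact: below_lam.
- have [d bE] := linked_target pre' ab; have [e cE] := linked_target pre' bc.
  move: IHab IHbc; rewrite {}cE {ab bc}bE /= !(drop_size_cat _ erefl) -catA
    (drop_size_cat _ erefl).
  move=> pd pe.
  have : below p (rs_plus (word_max a * word_max d) * (word_max (a ++ d) * word_max e)).
    by apply/below_mul.
  rewrite rs_mulA -word_max_mul -rs_mulA word_max_mul => /below_trans; apply.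
  apply: below_mul2l; apply: natural_le_below.
  by exists (rs_plus (word_max d * word_max e)) => //; eexists.
Qed.

Lemma covered_below u v : covered (edges [::] v) (edges [::] u) ->
  below (eval f u) (eval f v).
Proof.
move=> vu; have /below_edges uG : below (eval f u) (word_max [::] * eval f u).
  by rewrite word_max_nil lam_mul; exact: below_refl.
rewrite -(lam_mul (eval f v)) -word_max_nil; apply/below_edges => -[k a b] /vu.
case: k => -[st ab]; first by apply: uG; exact: st.
by apply: below_linked uG ab => k s t; exact: edges_target.
Qed.

Lemma covered_eval u v : content u = content v ->
  covered (edges [::] u) (edges [::] v) ->
  covered (edges [::] v) (edges [::] u) -> eval f u = eval f v.
Proof.
move=> uv cuv cvu; rewrite eval_content [RHS]eval_content uv.
by congr (_ * _); apply: below_anti; exact: covered_below.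
Qed.

End ValuesAreMeets.
End Evaluation.

(** * The semigroup of closed edge sets *)

Section EdgeModel.
Variable X : Type.
Implicit Types (a b c m n : seq X) (u v : term X) (A B C : edge X -> Prop).

(** Arbitrary edge sets need two rules more than edges of terms: they must be
    rooted at the empty word, whose loop belongs to all of them as it stands for
    the greatest projection. *)
Inductive closure A : edge X -> Prop :=
| closure_in e : A e -> closure A e
| closure_weak a b : closure A (Edge true a b) -> closure A (Edge false a b)
| closure_refl a b : closure A (Edge false a b) -> closure A (Edge false a a)
| closure_root a b : closure A (Edge false a b) -> closure A (Edge false [::] a)
| closure_nil : closure A (Edge false [::] [::])
| closure_trans a b c : closure A (Edge false a b) ->
    closure A (Edge false b c) -> closure A (Edge false a c).

Definition closed A : Prop := forall e, closure A e -> A e.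

Lemma closure_min A B : closed B -> (forall e, A e -> B e) ->
  forall e, closure A e -> B e.
Proof.
move=> clB AB e; elim=> {e} [e /AB //|a b _ /closure_in ab|a b _ /closure_in ab
  |a b _ /closure_in ab||a b c _ /closure_in ab _ /closure_in bc]; apply: clB.
- exact: closure_weak ab.
- exact: closure_refl ab.
- exact: closure_root ab.
- exact: closure_nil.
- exact: closure_trans ab bc.
Qed.

Lemma closed_closure A : closed (closure A).
Proof.
move=> e; elim=> {e} [//|a b _|a b _|a b _||a b c _ ab _].
- exact: closure_weak.
- exact: closure_refl.
- exact: closure_root.
- exact: closure_nil.
- exact: closure_trans.
Qed.

(** Translation by m does not preserve the root rule, which is about the empty
    word. Carrying along that m is linked to every translated source repairs the
    induction. *)
Lemma closure_shift m A B : closed B -> B (Edge false m m) ->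
  (forall k a b, A (Edge k a b) ->
     B (Edge k (m ++ a) (m ++ b)) /\ B (Edge false m (m ++ a))) ->
  forall e, closure A e ->
    B (Edge (strong e) (m ++ source e) (m ++ target e)) /\
    B (Edge false m (m ++ source e)).
Proof.
move=> clB mm AB e; elim=> {e} [[k a b] /AB //|||||] /=.
- move=> a b _ [/closure_in ab ma]; split=> //; exact/clB/closure_weak.
- move=> a b _ [/closure_in ab ma]; split=> //.
  exact/clB/(closure_refl ab).
- by move=> a b _ [_ ma]; rewrite cats0.
- by rewrite cats0.
- move=> a b c _ [/closure_in ab ma] _ [/closure_in bc _]; split=> //.
  exact/clB/(closure_trans ab bc).
Qed.

Definition shift m A : edge X -> Prop := fun e =>
  exists k a b, e = Edge k (m ++ a) (m ++ b) /\ A (Edge k a b).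

Lemma shift_in m A k a b : A (Edge k a b) -> shift m A (Edge k (m ++ a) (m ++ b)).
Proof. by move=> ab; exists k, a, b. Qed.

Lemma shift_nil A : shift [::] A = A.
Proof.
apply/funext => -[k a b]; apply/propext; split; last exact: (@shift_in [::]).
by move=> [k' [a' [b' [[-> -> ->]]]]].
Qed.

(** The projection of a product whose left factor has end point m. *)
Definition glue A m B := closure (fun e => A e \/ shift m B e).

Lemma glue_l A m B e : A e -> glue A m B e.
Proof. by move=> ?; apply: closure_in; left. Qed.

Lemma glue_r A m B k a b : B (Edge k a b) ->
  glue A m B (Edge k (m ++ a) (m ++ b)).
Proof. by move=> ?; apply: closure_in; right; exact: shift_in. Qed.

Lemma glue_r0 A m B b : B (Edge false [::] b) ->
  glue A m B (Edge false m (m ++ b)).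
Proof. by move=> /(@glue_r A m); rewrite cats0. Qed.

Lemma glue_min A m B C : closed C -> (forall e, A e -> C e) ->
  (forall k a b, B (Edge k a b) -> C (Edge k (m ++ a) (m ++ b))) ->
  forall e, glue A m B e -> C e.
Proof.
move=> clC AC BC; apply: closure_min => // e [/AC //|[k [a [b [-> /BC //]]]]].
Qed.

Lemma set_ext A B : (forall e, A e -> B e) -> (forall e, B e -> A e) -> A = B.
Proof.
by move=> AB BA; apply/funext => e; apply/propext; split; [exact: AB|exact: BA].
Qed.

(** The edge set stands for a projection and the end point for a sigma-class;
    the last field says that the projection lies below that of the greatest
    element of the class. *)
Record pointed := Pointed {
  edge_set : edge X -> Prop;
  endpoint : seq X;
  edge_set_closed : closed edge_set;
  edge_set_endpoint : edge_set (Edge false [::] endpoint)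
}.

Implicit Types s t x y : pointed.

Lemma pointed_ext s t : edge_set s = edge_set t -> endpoint s = endpoint t -> s = t.
Proof.
case: s t => [A m clA Am] [B n clB Bn] /= AB mn; case: _ / AB clB Bn => clB.
by case: _ / mn => Bn; congr Pointed; exact: Prop_irrelevance.
Qed.

Lemma closed_root s k a b : edge_set s (Edge k a b) -> edge_set s (Edge false [::] a).
Proof.
move=> /closure_in ab; apply: edge_set_closed; apply: (@closure_root _ _ b).
by case: k ab => // ab; exact: closure_weak.
Qed.

Lemma closed_nil s : edge_set s (Edge false [::] [::]).
Proof. exact/edge_set_closed/closure_nil. Qed.

Lemma glue_shift C s m : closed C ->
  (forall k a b, edge_set s (Edge k a b) -> C (Edge k (m ++ a) (m ++ b))) ->
  forall k a b, edge_set s (Edge k a b) ->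
     C (Edge k (m ++ a) (m ++ b)) /\ C (Edge false m (m ++ a)).
Proof.
move=> clC sC k a b ab; split; first exact: sC.
by rewrite -[X in Edge false X _]cats0; apply/sC/(closed_root ab).
Qed.

Lemma mul_endpoint s t :
  glue (edge_set s) (endpoint s) (edge_set t)
    (Edge false [::] (endpoint s ++ endpoint t)).
Proof.
apply: closure_trans; first exact/glue_l/edge_set_endpoint.
exact/glue_r0/edge_set_endpoint.
Qed.

Definition pointed_mul s t : pointed :=
  Pointed (@closed_closure _) (mul_endpoint s t).

Definition pointed_plus s : pointed :=
  Pointed (@edge_set_closed s) (closed_nil s).

Lemma single_endpoint m :
  closure (fun e => e = Edge false [::] m) (Edge false [::] m).
Proof. exact: closure_in. Qed.

Definition pointed_single m : pointed :=
  Pointed (@closed_closure _) (single_endpoint m).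

Lemma pointed_mulA s t x :
  pointed_mul s (pointed_mul t x) = pointed_mul (pointed_mul s t) x.
Proof.
apply: pointed_ext; last exact: catA.
apply: set_ext => /= e; apply: glue_min; try exact: closed_closure.
- by move=> {}e se; do 2!apply: glue_l.
- move=> k a b /(closure_shift (m := endpoint s)
    (B := glue (glue (edge_set s) (endpoint s) (edge_set t))
            (endpoint s ++ endpoint t) (edge_set x))) [] //.
  + exact: closed_closure.
  + rewrite -[X in Edge false _ X]cats0; exact/glue_l/glue_r0/closed_nil.
  + have tC : forall k a b, edge_set t (Edge k a b) ->
       glue (glue (edge_set s) (endpoint s) (edge_set t))
            (endpoint s ++ endpoint t) (edge_set x)
            (Edge k (endpoint s ++ a) (endpoint s ++ b)).
      by move=> *; apply/glue_l/glue_r.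
    move=> {}k {}a {}b [tab|[k' [a' [b' [[-> -> ->] xab]]]]].
      by apply: glue_shift tab; [exact: closed_closure|exact: tC].
    split; rewrite !catA; first exact: glue_r.
    apply: (@closure_trans _ _ (endpoint s ++ endpoint t)).
      exact/glue_l/glue_r0/edge_set_endpoint.
    exact/glue_r0/(closed_root xab).
- apply: glue_min; first exact: closed_closure.
    by move=> {}e se; apply: glue_l.
  by move=> k a b tab; apply/glue_r/glue_l.
- by move=> k a b xab; rewrite -!catA; apply/glue_r/glue_r.
Qed.

Lemma glue_id s : glue (edge_set s) [::] (edge_set s) = edge_set s.
Proof.
apply: set_ext => e; last exact: glue_l.
by apply: glue_min => //; exact: edge_set_closed.
Qed.

Lemma pointed_plus_mul s : pointed_mul (pointed_plus s) s = s.
Proof. by apply: pointed_ext => //=; exact: glue_id. Qed.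

Lemma pointed_plusC s t :
  pointed_mul (pointed_plus s) (pointed_plus t) =
  pointed_mul (pointed_plus t) (pointed_plus s).
Proof.
apply: pointed_ext => //=; rewrite /glue !shift_nil.
by congr closure; apply/funext => e; apply/propext; split=> -[]; tauto.
Qed.

Lemma pointed_plusM s t :
  pointed_plus (pointed_mul (pointed_plus s) t) =
  pointed_mul (pointed_plus s) (pointed_plus t).
Proof. exact: pointed_ext. Qed.

Lemma pointed_mul_plus s t :
  pointed_mul s (pointed_plus t) =
  pointed_mul (pointed_plus (pointed_mul s t)) s.
Proof.
apply: pointed_ext; last by rewrite /= cats0.
apply: set_ext => /= e; first exact: glue_l.
apply: glue_min => //; first exact: closed_closure.
by move=> k a b sab; exact: glue_l.
Qed.

Definition pointed_restriction : restriction_semigroup :=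
  RestrictionSemigroup pointed_mulA pointed_plus_mul pointed_plusC
    pointed_plusM pointed_mul_plus.

(** More edges mean a smaller projection. *)
Lemma pointed_leE s t :
  @natural_le pointed_restriction s t <->
  endpoint s = endpoint t /\ (forall e, edge_set t e -> edge_set s e).
Proof.
split=> [[_ [x ->] ->]|[st ts]].
  by split=> // -[k a b]; exact: (@glue_r _ [::]).
apply/natural_leE; apply: pointed_ext => //=.
apply: set_ext => e; first exact: glue_l.
by apply: glue_min => [|//|k a b /ts]; first exact: edge_set_closed.
Qed.

Lemma pointed_sigmaE s t :
  @sigma pointed_restriction s t <-> endpoint s = endpoint t.
Proof.
split=> [[_ [x ->]] /(congr1 endpoint) //|st].
exists (pointed_mul (pointed_plus s) (pointed_plus t)).
  by exists (pointed_mul (pointed_plus s) (pointed_plus t)); exact: pointed_ext.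
apply: pointed_ext => //=; rewrite /glue !shift_nil.
apply: set_ext; apply: closure_min; try exact: closed_closure.
- by move=> e [?|te]; apply: closure_in; left=> //; apply: closure_in; left.
- by move=> e [?|te]; apply: closure_in; left=> //; apply: closure_in; right.
Qed.

Lemma single_min m A : closed A -> A (Edge false [::] m) ->
  forall e, edge_set (pointed_single m) e -> A e.
Proof. by move=> clA Am; apply: closure_min => // e ->. Qed.

Lemma pointed_maxP (s : pointed_restriction) :
  sigma_class_max s (pointed_single (endpoint s) : pointed_restriction).
Proof.
split=> [|t /pointed_sigmaE st]; first exact/pointed_sigmaE.
apply/pointed_leE; split=> //; rewrite st; apply: single_min.
  exact: edge_set_closed.
exact: edge_set_endpoint.
Qed.

Lemma pointed_lamP :
  max_projection (pointed_single [::] : pointed_restriction).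
Proof.
split=> [|_ [s ->]]; first by exists (pointed_single [::]); exact: pointed_ext.
apply/pointed_leE; split=> //; apply: single_min; first exact: edge_set_closed.
exact: closed_nil.
Qed.

Definition pointed_F : F_restriction_semigroup :=
  FRestrictionSemigroup pointed_maxP pointed_lamP.

Lemma letter_endpoint (x : X) :
  closure (fun e => e = Edge true [::] [:: x]) (Edge false [::] [:: x]).
Proof. exact/closure_weak/closure_in. Qed.

Definition pointed_letter (x : X) : pointed_F :=
  Pointed (@closed_closure _) (letter_endpoint x).

Lemma linked_closure (G : seq (edge X)) a b : linked G a b ->
  closure (fun e => e \in G) (Edge false a b).
Proof.
have st k (s t : seq X) : Edge k s t \in G -> closure (fun e => e \in G) (Edge false s t).
  by case: k => st; first apply: closure_weak; exact: closure_in.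
elim=> {a b} [k a b /st //|k a b /st|a b c _ ab _]; first exact: closure_refl.
exact: closure_trans.
Qed.

(** For the edges of a term the root rule adds nothing, by [edges_rooted]. *)
Lemma closure_rooted u e : closure (fun e => e \in edges [::] u) e ->
  [/\ strong e -> e \in edges [::] u,
     linked (edges [::] u) (source e) (target e)
   & linked (edges [::] u) [::] (source e)].
Proof.
have [nn _ root] := edges_rooted [::] u.
elim=> {e} [[k a b] ab||||//|] /=.
- split; [by []|exact: linked_edge ab|exact: root ab].
- by move=> a b _ [].
- move=> a b _ [_ ab na]; split=> //.
  by elim: ab {na} => // {}k s t st; exact: linked_refl st.
- by move=> a b _ [].
- by move=> a b c _ [_ ab na] _ [_ bc _]; split=> //; exact: linked_trans ab bc.
Qed.

Lemma closure_linked u k a b :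
  closure (fun e => e \in edges [::] u) (Edge k a b) ->
  (k -> Edge true a b \in edges [::] u) /\ linked (edges [::] u) a b.
Proof.
by move=> /closure_rooted[/= kab ab _]; split=> // kT; move: kab; rewrite kT; apply.
Qed.

Lemma mem_singleton (e0 : edge X) :
  (fun e => e = e0) = (fun e => e \in [:: e0]).
Proof.
by apply/funext => e; rewrite mem_seq1; apply/propext; split=> [->|/eqP].
Qed.

(** In a product the edges of the right factor may be closed before or after
    their translation, because they are rooted. *)
Lemma eval_pointed u :
  endpoint (eval pointed_letter u) = content u /\
  edge_set (eval pointed_letter u) = closure (fun e => e \in edges [::] u).
Proof.
elim: u => [x||v [ev IHv] w [ew IHw]|v [_ IHv]|v [ev IHv]] //=.
- by rewrite -mem_singleton.
- by rewrite -mem_singleton.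
- split; first by rewrite ev ew.
  rewrite ev IHv IHw; apply: set_ext => e; last first.
    apply: closure_min => {e}; first exact: closed_closure.
    move=> [k a b]; rewrite mem_cat => /orP[ab|/edges_unshift].
      exact/glue_l/closure_in.
    by move=> [a' [b' [-> -> ab]]]; apply/glue_r/closure_in.
  have [vv _ rootw] := edges_rooted (content v) w.
  have subr : {subset edges (content v) w <= edges [::] (Mul v w)}.
    by move=> ? /= ?; rewrite mem_cat orbC; apply/orP; left.
  apply: glue_min => {e}; first exact: closed_closure.
    apply: closure_min; first exact: closed_closure.
    by move=> e ?; apply: closure_in; rewrite mem_cat; apply/orP; left.
  move=> k a b ab; suff [] : closure (fun e => e \in edges [::] (Mul v w))
     (Edge k (content v ++ a) (content v ++ b)) /\
    closure (fun e => e \in edges [::] (Mul v w))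
     (Edge false (content v) (content v ++ a)) by [].
  apply: closure_shift ab; first exact: closed_closure.
    exact/linked_closure/(linked_sub subr).
  move=> {}k {}a {}b /(edges_shift (content v)); rewrite cats0 => ab.
  split; first exact/closure_in/subr.
  exact/linked_closure/(linked_sub subr)/(rootw _ _ _ ab).
- by rewrite -mem_singleton ev.
Qed.

Lemma valid_covered u v : valid_identity u v ->
  content u = content v /\ covered (edges [::] u) (edges [::] v).
Proof.
move=> /(_ _ pointed_letter) uv; have [cu Gu] := eval_pointed u.
have [cv Gv] := eval_pointed v; split; first by rewrite -cu uv.
move=> k a b ab; apply: closure_linked; rewrite -Gv -uv Gu.
exact: closure_in.
Qed.

Theorem same_valueE u v : same_value (u, v) <->
  [/\ content u = content v, covered (edges [::] u) (edges [::] v)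
    & covered (edges [::] v) (edges [::] u)].
Proof.
rewrite /same_value !valueE clsP; split=> [uv|[cuv Guv Gvu] R f].
  have [cuv Guv] := valid_covered uv.
  by have [] // := @valid_covered v u (fun R f => esym (uv R f)).
exact: covered_eval.
Qed.

End EdgeModel.

(** * Weakest preconditions with running time *)

Section WeakestPreconditions.
Variables (X : Type) (inp : seq (symbol X)).
Implicit Types (p : program) (m : memory) (Q : nat -> memory -> Prop).

(** Termination is part of the meaning. The postcondition receives the number of
    steps, so that bounds are accumulated by the rules below and settled once,
    at the end of each straight-line piece. *)
Definition wp p Q m := exists k m', exec inp p m k m' /\ Q k m'.

Lemma wp_mono p Q Q' m :
  wp p Q m -> (forall k m', Q k m' -> Q' k m') -> wp p Q' m.
Proof. by move=> [k [m' [pm /[swap] QQ /QQ]]]; exists k, m'. Qed.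

Lemma wp_skip Q m : Q 1 m -> wp Skip Q m.
Proof. by move=> Qm; exists 1, m; split=> //; constructor. Qed.

Lemma wp_setreg r e Q m :
  Q (expr_cost e).+1 (set_reg m r (expr_val m e)) -> wp (SetReg r e) Q m.
Proof. by move=> Qm; do 2!eexists; split; last exact: Qm; constructor. Qed.

Lemma wp_setarr r e1 e2 Q m :
  Q (expr_cost e1 + expr_cost e2).+1
    (set_arr m r (expr_val m e1) (expr_val m e2)) ->
  wp (SetArr r e1 e2) Q m.
Proof. by move=> Qm; do 2!eexists; split; last exact: Qm; constructor. Qed.

Lemma wp_seq p1 p2 Q m :
  wp p1 (fun k1 m1 => wp p2 (fun k2 m2 => Q (k1 + k2) m2) m1) m ->
  wp (Seq p1 p2) Q m.
Proof.
move=> [k1 [m1 [e1 [k2 [m2 [e2 Qm]]]]]]; exists (k1 + k2), m2; split=> //.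
exact: ExecSeq e1 e2.
Qed.

Lemma wp_if t p1 p2 Q m :
  (test_holds inp m t -> wp p1 (fun k m' => Q (test_cost t + k).+1 m') m) ->
  (~ test_holds inp m t -> wp p2 (fun k m' => Q (test_cost t + k).+1 m') m) ->
  wp (If t p1 p2) Q m.
Proof.
case: (pselect (test_holds inp m t)) => tm.
  by move=> /(_ tm) [k [m' [e1 Qm]]] _; do 2!eexists; split;
    [exact: ExecIfTrue e1|exact: Qm].
by move=> _ /(_ tm) [k [m' [e1 Qm]]]; do 2!eexists; split;
    [exact: ExecIfFalse e1|exact: Qm].
Qed.

Lemma wp_while_true t p Q m : test_holds inp m t ->
  wp p (fun k1 m1 =>
    wp (While t p) (fun k2 m2 => Q (test_cost t + k1 + k2).+1 m2) m1) m ->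
  wp (While t p) Q m.
Proof.
move=> tm [k1 [m1 [e1 [k2 [m2 [e2 Qm]]]]]]; do 2!eexists; split; last exact: Qm.
exact: ExecWhileTrue e1 e2.
Qed.

Lemma wp_while_false t p Q m : ~ test_holds inp m t ->
  Q (test_cost t).+1 m -> wp (While t p) Q m.
Proof. by move=> tm Qm; do 2!eexists; split; last exact: Qm; constructor. Qed.

Definition for_loop j e h body : program :=
  Seq (SetReg j e)
    (While (Leq (Add (Reg j) (Const 1)) (Reg h))
       (Seq body (SetReg j (Add (Reg j) (Const 1))))).

(** The invariant is evaluated with the loop counter already advanced, which
    spares the body any knowledge of how the counter is updated. *)
Lemma wp_for j e h body (I : nat -> memory -> Prop) c H Q m :
  j != h -> expr_val m e <= H -> reg m h = H ->
  I (expr_val m e) (set_reg m j (expr_val m e)) ->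
  (forall i m', expr_val m e <= i < H -> reg m' j = i -> reg m' h = H ->
     I i m' ->
     wp body (fun k m'' => [/\ k <= c, reg m'' j = i, reg m'' h = H
                            & I i.+1 (set_reg m'' j i.+1)]) m') ->
  (forall k m', k <= expr_cost e + 7 + (H - expr_val m e) * (c + 10) ->
     reg m' h = H -> I H m' -> Q k m') ->
  wp (for_loop j e h body) Q m.
Proof.
move=> jh leH mh Im step Qend; apply/wp_seq/wp_setreg.
set lo := expr_val m e in leH Im step Qend *.
have loop n i m0 : n = H - i -> lo <= i <= H -> reg m0 j = i ->
    reg m0 h = H -> I i m0 ->
    wp (While (Leq (Add (Reg j) (Const 1)) (Reg h))
         (Seq body (SetReg j (Add (Reg j) (Const 1)))))
      (fun k m' => [/\ k <= n * (c + 10) + 6, reg m' h = H & I H m']) m0.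
  elim: n i m0 => [|n IHn] i m0 nE iH m0j m0h Im0.
    have iE : i = H by lia.
    apply: wp_while_false; first by rewrite /= m0j m0h; lia.
    by rewrite -{2}iE.
  apply: wp_while_true; first by rewrite /= m0j m0h; lia.
  apply/wp_seq; apply: wp_mono (step i m0 _ m0j m0h Im0) _; first lia.
  move=> k1 m1 [k1c m1j m1h Im1]; apply: wp_setreg; rewrite /= m1j (addn1 i).
  apply: wp_mono (IHn i.+1 _ _ _ _ _ Im1) _; rewrite /= ?eqxx //; try lia.
    by rewrite eq_sym (negPf jh).
  by move=> k m' [kc m'h Im']; split=> //; lia.
apply: wp_mono (loop (H - lo) lo _ erefl _ _ _ Im) _; rewrite /= ?eqxx ?leqnn //.
  by rewrite eq_sym (negPf jh).
by move=> k m' [kc m'h Im']; apply: Qend => //; lia.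
Qed.

End WeakestPreconditions.

Ltac step := first
  [ apply: wp_seq | apply: wp_setreg | apply: wp_setarr | apply: wp_skip ].

(** * The traversal program *)

(** The registers: the answer, the input position, the current trie node, the
    sizes of the trie, of the edge list and of the task stack, the number of
    enclosing maxima, the two ends of an edge, loop counters, and the data of
    the comparison phase. *)
Local Notation rAns := 0 (only parsing).
Local Notation rPos := 1 (only parsing).
Local Notation rCur := 2 (only parsing).
Local Notation rNodes := 3 (only parsing).
Local Notation rEdges := 4 (only parsing).
Local Notation rTasks := 5 (only parsing).
Local Notation rDepth := 6 (only parsing).
Local Notation rSrc := 7 (only parsing).
Local Notation rDst := 8 (only parsing).
Local Notation rI := 9 (only parsing).
Local Notation rJ := 10 (only parsing).
Local Notation rStamp := 11 (only parsing).
Local Notation rFlag := 12 (only parsing).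
Local Notation rLo1 := 13 (only parsing).
Local Notation rHi1 := 14 (only parsing).
Local Notation rLo2 := 15 (only parsing).
Local Notation rHi2 := 16 (only parsing).
Local Notation rQuery := 17 (only parsing).
Local Notation rSplit := 18 (only parsing).
Local Notation rEnd := 19 (only parsing).

(** The arrays: parent node and input position of the letter of each trie node,
    the edge list, the task stack with the node saved by each task, and marks on
    nodes. *)
Local Notation aParent := 0 (only parsing).
Local Notation aLetter := 1 (only parsing).
Local Notation aSrc := 2 (only parsing).
Local Notation aDst := 3 (only parsing).
Local Notation aStrong := 4 (only parsing).
Local Notation aTask := 5 (only parsing).
Local Notation aNode := 6 (only parsing).
Local Notation aMark := 7 (only parsing).

(** The tasks: read a term, and leave the scope of a plus or of a maximum. *)
Local Notation tTerm := 0 (only parsing).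
Local Notation tPlus := 1 (only parsing).
Local Notation tMax := 2 (only parsing).

Fixpoint block (ps : seq program) : program :=
  match ps with
  | [::] => Skip
  | [:: p] => p
  | p :: ps' => Seq p (block ps')
  end.

Definition equal (e1 e2 : expr) : test := And (Leq e1 e2) (Leq e2 e1).

Definition incr (r : nat) : program := SetReg r (Add (Reg r) (Const 1)).

Definition push_task (task : nat) : program := block
  [:: SetArr aTask (Reg rTasks) (Const task);
      SetArr aNode (Reg rTasks) (Reg rCur);
      incr rTasks].

(** Inside a maximum the truncated subtraction is zero, so that the edge is left
    beyond the end of the list and overwritten later. *)
Definition add_edge (k : bool) : program := block
  [:: SetArr aSrc (Reg rEdges) (Reg rSrc);
      SetArr aDst (Reg rEdges) (Reg rDst);
      SetArr aStrong (Reg rEdges) (Const k);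
      SetReg rEdges (Add (Reg rEdges) (Sub (Const 1) (Reg rDepth)))].

(** The default answer is the first unused node number, which is then
    allocated. *)
Definition find_child : program := block
  [:: SetReg rDst (Reg rNodes);
      for_loop rJ (Const 1) rNodes
        (If (And (equal (Arr aParent (Reg rJ)) (Reg rCur))
               (InputSame (Arr aLetter (Reg rJ)) (Reg rPos)))
           (SetReg rDst (Reg rJ)) Skip);
      If (Leq (Reg rNodes) (Reg rDst))
        (block [:: SetArr aParent (Reg rNodes) (Reg rCur);
                   SetArr aLetter (Reg rNodes) (Reg rPos);
                   incr rNodes])
        Skip].

(** A product only schedules its factors: the current node is threaded from the
    first to the second. *)
Definition read_symbol : program := block
  [:: SetReg rSrc (Reg rCur);
      If (InputOper OpLam (Reg rPos))
        (block [:: SetReg rDst (Reg rCur); add_edge false])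
     (If (InputOper OpMul (Reg rPos))
        (block [:: push_task tTerm; push_task tTerm])
     (If (InputOper OpPlus (Reg rPos))
        (block [:: push_task tPlus; push_task tTerm])
     (If (InputOper OpMax (Reg rPos))
        (block [:: push_task tMax; push_task tTerm; incr rDepth])
        (block [:: find_child; add_edge true; SetReg rCur (Reg rDst)]))));
      incr rPos].

Definition do_task : program := block
  [:: SetReg rTasks (Sub (Reg rTasks) (Const 1));
      If (Leq (Arr aTask (Reg rTasks)) (Const tTerm)) read_symbol
     (If (Leq (Arr aTask (Reg rTasks)) (Const tPlus))
        (SetReg rCur (Arr aNode (Reg rTasks)))
        (block [:: SetReg rDepth (Sub (Reg rDepth) (Const 1));
                   SetReg rSrc (Arr aNode (Reg rTasks));
                   SetReg rDst (Reg rCur);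
                   add_edge false]))].

Definition do_tasks : program := While (Leq (Const 1) (Reg rTasks)) do_task.

Definition traverse : program := block
  [:: SetArr aTask (Reg rTasks) (Const tTerm); incr rTasks; do_tasks].

(** * Correctness of the traversal *)

Local Notation word_at := (nth [::]).
Local Notation edge_at := (nth (Edge false [::] [::])).

Section Traversal.
Variables (X : Type) (inp : seq (symbol X)).
Implicit Types (m : memory) (W : seq (seq X)) (es : seq (edge X)) (u : term X).

(** [W] lists the words of the nodes. Parents come first, which orders prefixes
    before their extensions. *)
Definition trie W (parent letter : nat -> nat) : Prop :=
  [/\ 0 < size W, word_at W 0 = [::],
      forall i j, i < size W -> j < size W -> word_at W i = word_at W j -> i = j
    & forall i, 0 < i < size W -> parent i < i /\
        exists2 x, onth inp (letter i) = Some (Letter x) &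
          word_at W i = rcons (word_at W (parent i)) x].

Definition stored W es (src dst str : nat -> nat) : Prop :=
  forall j, j < size es -> [/\ src j < size W, dst j < size W &
    edge_at es j = Edge (0 < str j) (word_at W (src j)) (word_at W (dst j))].

Record represents m W es : Prop := Represents {
  rep_nodes : reg m rNodes = size W;
  rep_edges : reg m rEdges = size es;
  rep_trie : trie W (arr m aParent) (arr m aLetter);
  rep_stored : stored W es (arr m aSrc) (arr m aDst) (arr m aStrong)
}.

Definition upd (f : nat -> nat) (i a : nat) : nat -> nat :=
  fun j => if j == i then a else f j.

(** Follow parents from the node of the longer word. *)
Lemma trie_le W par let_ i j c : trie W par let_ -> i < size W -> j < size W ->
  word_at W j = word_at W i ++ c -> i <= j.
Proof.
move=> [_ W0 inj up] iW; elim/last_ind: c j => [|c x IHc] j jW ij.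
  by rewrite cats0 in ij; rewrite (inj _ _ jW iW ij).
case: (posnP j) => [j0|j_gt0].
  by move: ij; rewrite j0 W0 -rcons_cat; case: (_ ++ _).
have [|pj [y _]] := up j; first by rewrite j_gt0.
rewrite ij -rcons_cat => /rcons_inj[/esym ijp _].
by apply: leq_trans (ltnW pj); apply: IHc => //; exact: ltn_trans jW.
Qed.

Lemma trie_rcons W par let_ p l x : trie W par let_ -> p < size W ->
  onth inp l = Some (Letter x) ->
  (forall i, 0 < i < size W -> word_at W i <> rcons (word_at W p) x) ->
  trie (rcons W (rcons (word_at W p) x)) (upd par (size W) p) (upd let_ (size W) l).
Proof.
move=> [W_gt0 W0 inj up] pW lx new.
have newW i : i < size W -> word_at W i <> rcons (word_at W p) x.
  case: (posnP i) => [-> _|i_gt0 iW]; last by apply: new; rewrite i_gt0.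
  by rewrite W0; case: (word_at W p).
split; rewrite ?size_rcons //.
- by rewrite nth_rcons W_gt0.
- move=> i j; rewrite !ltnS !nth_rcons => iW jW.
  case: (ltngtP i (size W)) iW => // [iW|iW] _;
    case: (ltngtP j (size W)) jW => // [jW|jW] _.
  + exact: inj.
  + by move=> /newW; case.
  + by move=> /esym /newW; case.
  + by rewrite iW jW.
- move=> i /andP[i_gt0]; rewrite ltnS /upd nth_rcons => iW.
  case: (ltngtP i (size W)) iW => // [iW|->] _.
    have [|pi [y ly iy]] := up i; first by rewrite i_gt0.
    by split=> //; exists y; rewrite // nth_rcons (ltn_trans pi iW).
  by split=> //; exists x; rewrite // nth_rcons pW.
Qed.

Lemma stored_rcons W es src dst str w :
  stored W es src dst str -> stored (rcons W w) es src dst str.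
Proof.
move=> st j /st[sW dW ->]; rewrite !nth_rcons sW dW size_rcons.
by split=> //; rewrite ltnW.
Qed.

(** Edges are recorded outside all maxima only, that is at depth 0. *)
Definition emit (d : nat) es : seq (edge X) := if d == 0 then es else [::].

Lemma stored_emit W es src dst str d s t (k : bool) :
  s < size W -> t < size W -> stored W es src dst str ->
  stored W (es ++ emit d [:: Edge k (word_at W s) (word_at W t)])
    (upd src (size es) s) (upd dst (size es) t) (upd str (size es) k).
Proof.
move=> sW tW st j; rewrite size_cat nth_cat /upd /emit.
case: (ltngtP j (size es)) => [jes _|jes|->]; first exact: st.
  by case: eqP => _ /=; lia.
by rewrite subnn; case: eqP => _ /=; [move=> _; split=> //; case: (k)|lia].
Qed.

(** The part of the task stack below height s is what a task of height s
    leaves to its caller. *)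
Definition kept (s : nat) m m' : Prop := forall j, j < s ->
  arr m' aTask j = arr m aTask j /\ arr m' aNode j = arr m aNode j.

Record at_point m pos cur d s W es : Prop := AtPoint {
  at_pos : reg m rPos = pos;
  at_cur : reg m rCur = cur;
  at_depth : reg m rDepth = d;
  at_tasks : reg m rTasks = s;
  at_cur_node : cur < size W;
  at_represents : represents m W es
}.

Lemma wp_add_edge m pos cur d s W es (k : bool) i j :
  at_point m pos cur d s W es -> reg m rSrc = i -> reg m rDst = j ->
  i < size W -> j < size W ->
  wp inp (add_edge k) (fun c m' =>
    [/\ c <= 20, at_point m' pos cur d s W
          (es ++ emit d [:: Edge k (word_at W i) (word_at W j)]),
        reg m' rDst = j & kept s m m']) m.
Proof.
move=> [mp mc md ms cW [mN mE mtrie mst]] mi mj iW jW.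
rewrite /add_edge /=; do 7!step; split=> //=.
split=> //=; split=> //=.
- by rewrite mE md size_cat /emit; case: (d).
- by rewrite mE mi mj; exact: stored_emit.
Qed.

Definition same_but (l : seq nat) m m' : Prop :=
  arr m' = arr m /\ forall r, r \notin l -> reg m' r = reg m r.

Lemma rcons_word_at W par let_ x y i j : trie W par let_ ->
  i < size W -> j < size W ->
  rcons (word_at W i) x = rcons (word_at W j) y -> i = j /\ x = y.
Proof. by move=> [_ _ inj _] iW jW /rcons_inj[/inj -> // ->]. Qed.

Lemma wp_find_child m pos cur d s W es x :
  at_point m pos cur d s W es -> onth inp pos = Some (Letter x) ->
  wp inp find_child (fun c m' => exists W',
    [/\ c <= 35 * size W + 40, at_point m' pos cur d s W' es,
        reg m' rSrc = reg m rSrc /\ kept s m m',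
        reg m' rDst < size W' /\
          word_at W' (reg m' rDst) = rcons (word_at W cur) x
      & W' = W \/ W' = rcons W (rcons (word_at W cur) x)]) m.
Proof.
move=> [mp mc md ms cW [mN mE mtrie mst]] px.
pose target := rcons (word_at W cur) x.
have [W_gt0 W0 inj up] := mtrie.
rewrite /find_child /=; step; step => /=; step.
apply: (@wp_for _ _ _ _ _ _ (fun i m' => same_but [:: rDst; rJ] m m' /\
  ((reg m' rDst = size W /\ forall i', 0 < i' < i -> word_at W i' <> target) \/
   (reg m' rDst < size W /\ word_at W (reg m' rDst) = target))) 19 (size W)) => //=.
- split; last by left; split=> // i'; lia.
  by split=> //= r; rewrite !inE !negb_or => /andP[/negPf -> /negPf ->].
- move=> i m1 /andP[i_gt0 iW] m1j m1h [[m1a m1r] found].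
  have [|pi [y ly iy]] := up i; first by rewrite i_gt0.
  have eqi : (arr m 0 i <= cur /\ cur <= arr m 0 i) /\
      onth inp (arr m 1 i) = onth inp pos <-> word_at W i = target.
    rewrite ly px iy; split=> [[le [->]]|/(rcons_word_at mtrie) []].
      by have -> : arr m 0 i = cur by lia.
    + exact: ltn_trans iW.
    + exact: cW.
    + by move=> -> ->; rewrite leqnn.
  apply: wp_if => /= [|]; rewrite m1j m1a !m1r // mc mp eqi => hit; step => /=.
    rewrite m1h; split=> //; split.
      split=> //= r rl; move: (rl); rewrite !inE !negb_or => /andP[/negPf -> /negPf ->].
      exact: m1r.
    by right; rewrite m1j.
  split=> //; split.
    split=> //= r rl; move: (rl); rewrite !inE !negb_or => /andP[_ /negPf ->].
    exact: m1r.
  case: found => [[m1d new]|]; [left|by right]; split=> // i' i'i.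
  have [->|ne] := eqVneq i' i; first exact: hit.
  by apply: new; move: ne i'i; lia.
- move=> k m1 kc _ [[m1a m1r] found]; apply: wp_if => /=; rewrite (m1r 3) // mN.
    case: found => [[m1d new] _|[? _]]; last lia.
    do 5!step; exists (rcons W target) => /=; split; last by right.
    + by move: kc; clear; lia.
    + split; rewrite /= ?m1r ?mp ?mc ?md ?ms ?mN ?mE //; first by rewrite size_rcons ltnW.
      split; rewrite /= ?m1r ?mN ?mE ?size_rcons ?addn1 //.
        by rewrite m1a; exact: trie_rcons.
      by rewrite m1a; exact: stored_rcons.
    + by rewrite m1r //; split=> // j; rewrite /= m1a.
    + by rewrite m1d size_rcons nth_rcons ltnn eqxx.
  case: found => [[-> _]|[dW dt] _]; first by rewrite leqnn.
  step; exists W; split; [|split|split| |by left] => //=; rewrite ?m1r //.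
  + by move: kc; clear; lia.
  + by split; rewrite ?m1r ?m1a.
  + by rewrite /kept m1a.
Qed.

Lemma wp_task_lam m pos cur d s W es :
  at_point m pos cur d s.+1 W es -> arr m aTask s = tTerm ->
  onth inp pos = Some (Oper OpLam) ->
  wp inp do_task (fun c m' => c <= 60 /\ [/\ at_point m' pos.+1 cur d s W
     (es ++ emit d [:: Edge false (word_at W cur) (word_at W cur)])
     & kept s m m']) m.
Proof.
move=> pm tm px; rewrite /do_task /=; do 2!step => /=.
set m1 := set_reg _ _ _.
have pm1 : at_point m1 pos cur d s W es.
  by case: pm => mp mc md ms cW [mN mE mtrie mst]; split=> //=; rewrite ms subn1.
have am1 : arr m1 = arr m by [].
rewrite /kept -am1 in tm *; clearbody m1.
have ts : reg m1 rTasks = s by case: pm1.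
apply: wp_if => /=; rewrite ts tm // => _.
rewrite /read_symbol; do 3!step => /=.
have ps : reg m1 rPos = pos by case: pm1.
apply: wp_if => /=; rewrite ps px // => _.
rewrite /=; do 2!step => /=.
apply: wp_mono.
  apply: (@wp_add_edge _ pos cur d s W es false cur cur);
    by case: pm1 => mp mc md ms cW [mN mE mtrie mst]; first [done | split].
move=> c m2 [c20 [mp mc md ms cW [mN mE mtrie mst]] _ k12].
step; split; first by rewrite /=; lia.
by split=> //; split=> //=; rewrite mp addn1.
Qed.

Lemma wp_task_mul m pos cur d s W es :
  at_point m pos cur d s.+1 W es -> arr m aTask s = tTerm ->
  onth inp pos = Some (Oper OpMul) ->
  wp inp do_task (fun c m' => c <= 80 /\ [/\ at_point m' pos.+1 cur d s.+2 W es,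
    kept s m m', arr m' aTask s = tTerm & arr m' aTask s.+1 = tTerm]) m.
Proof.
move=> [mp mc md ms cW [mN mE mtrie mst]] tm px.
rewrite /do_task /=; do 2!step => /=.
apply: wp_if => /=; rewrite ms subn1 /= tm // => _.
rewrite /read_symbol; do 3!step => /=.
apply: wp_if => /=; rewrite mp px // => _.
apply: wp_if => /=; rewrite mp px // => _.
rewrite /=; do 12!step => /=; split; first by [].
rewrite /= ?addn1; split.
- by split; rewrite //= ?mp ?addn1.
- by move=> j js /=; case: eqP => [|_]; [lia|case: eqP => [|//]; lia].
- by rewrite eqxx; case: eqP.
- by rewrite eqxx.
Qed.

Lemma wp_task_plus m pos cur d s W es :
  at_point m pos cur d s.+1 W es -> arr m aTask s = tTerm ->
  onth inp pos = Some (Oper OpPlus) ->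
  wp inp do_task (fun c m' => c <= 80 /\ [/\ at_point m' pos.+1 cur d s.+2 W es,
    kept s m m', arr m' aTask s = tPlus, arr m' aNode s = cur
    & arr m' aTask s.+1 = tTerm]) m.
Proof.
move=> [mp mc md ms cW [mN mE mtrie mst]] tm px.
rewrite /do_task /=; do 2!step => /=.
apply: wp_if => /=; rewrite ms subn1 /= tm // => _.
rewrite /read_symbol; do 3!step => /=.
do 2!(apply: wp_if => /=; rewrite mp px // => _).
apply: wp_if => /=; rewrite mp px // => _.
rewrite /=; do 12!step => /=; split; first by [].
rewrite /= ?addn1; split.
- by split; rewrite //= ?mp ?addn1.
- by move=> j js /=; case: eqP => [|_]; [lia|case: eqP => [|//]; lia].
- by rewrite eqxx; case: eqP => //; lia.
- by rewrite eqxx; case: eqP => //; lia.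
- by rewrite eqxx.
Qed.

Lemma wp_task_max m pos cur d s W es :
  at_point m pos cur d s.+1 W es -> arr m aTask s = tTerm ->
  onth inp pos = Some (Oper OpMax) ->
  wp inp do_task (fun c m' => c <= 80 /\ [/\ at_point m' pos.+1 cur d.+1 s.+2 W es,
    kept s m m', arr m' aTask s = tMax, arr m' aNode s = cur
    & arr m' aTask s.+1 = tTerm]) m.
Proof.
move=> [mp mc md ms cW [mN mE mtrie mst]] tm px.
rewrite /do_task /=; do 2!step => /=.
apply: wp_if => /=; rewrite ms subn1 /= tm // => _.
rewrite /read_symbol; do 3!step => /=.
do 3!(apply: wp_if => /=; rewrite mp px // => _).
apply: wp_if => /=; rewrite mp px // => _.
rewrite /=; do 14!step => /=; split; first by [].
rewrite /= ?addn1; split.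
- by split; rewrite //= ?mp ?md ?addn1.
- by move=> j js /=; case: eqP => [|_]; [lia|case: eqP => [|//]; lia].
- by rewrite eqxx; case: eqP => //; lia.
- by rewrite eqxx; case: eqP => //; lia.
- by rewrite eqxx.
Qed.

Lemma wp_task_letter m pos cur d s W es x :
  at_point m pos cur d s.+1 W es -> arr m aTask s = tTerm ->
  onth inp pos = Some (Letter x) ->
  wp inp do_task (fun c m' => exists W' cur', c <= 35 * size W + 140 /\
    [/\ at_point m' pos.+1 cur' d s W'
          (es ++ emit d [:: Edge true (word_at W cur) (word_at W cur ++ [:: x])]),
        kept s m m', word_at W' cur' = word_at W cur ++ [:: x]
      & W' = W \/ W' = rcons W (word_at W cur ++ [:: x])]) m.
Proof.
move=> pm tm px; rewrite /do_task /=; do 2!step => /=.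
set m1 := set_reg _ _ _.
have pm1 : at_point m1 pos cur d s W es.
  by case: pm => mp mc md ms cW [mN mE mtrie mst]; split=> //=; rewrite ms subn1.
have am1 : arr m1 = arr m by [].
rewrite /kept -am1 in tm *; clearbody m1.
have ts : reg m1 rTasks = s by case: pm1.
apply: wp_if => /=; rewrite ts tm // => _.
rewrite /read_symbol; do 3!step => /=.
have ps : reg m1 rPos = pos by case: pm1.
do 4!(apply: wp_if => /=; rewrite ps px // => _).
rewrite /=; step => /=.
have pm2 : at_point (set_reg m1 7 (reg m1 2)) pos cur d s W es.
  by case: pm1 => mp mc md ms cW [mN mE mtrie mst]; split.
have cW : cur < size W by case: pm1.
have cs : reg m1 rCur = cur by case: pm1.
apply: wp_mono (wp_find_child pm2 px) _ => c m2 [W' [c35 pm3 [src3 k3] [dW dw] W'E]].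
have cW' : cur < size W' by case: W'E => ->; rewrite ?size_rcons // ltnS ltnW.
have wE : word_at W' cur = word_at W cur.
  by case: W'E => ->; rewrite ?nth_rcons ?cW.
step; apply: wp_mono.
  by apply: (wp_add_edge true pm3 _ erefl cW' dW); rewrite src3.
move=> c' m3 [c20 [mp mc md ms _ [mN mE mtrie mst]] m3d k4]; step; step.
exists W', (reg m2 rDst); split; first by rewrite /=; lia.
rewrite -cats1 in dw W'E; split=> //.
- split; rewrite /= ?mp ?addn1 //; split=> //=; last by rewrite -dw -wE.
  by rewrite mE -dw -wE.
- by move=> j js; have [/= -> ->] := k4 _ js; have [-> ->] := k3 _ js.
Qed.

Lemma wp_task_exit_plus m pos cur d s W es :
  at_point m pos cur d s.+1 W es -> arr m aTask s = tPlus ->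
  arr m aNode s < size W ->
  wp inp do_task (fun c m' => c <= 60 /\ [/\
    at_point m' pos (arr m aNode s) d s W es & kept s m m']) m.
Proof.
move=> [mp mc md ms cW [mN mE mtrie mst]] tm nW.
rewrite /do_task /=; do 2!step => /=.
apply: wp_if => /=; rewrite ms subn1 /= tm // => _.
apply: wp_if => /=; rewrite tm // => _.
by step; split=> //; split=> //; split=> //=; rewrite ms subn1.
Qed.

Lemma wp_task_exit_max m pos cur d s W es :
  at_point m pos cur d.+1 s.+1 W es -> arr m aTask s = tMax ->
  arr m aNode s < size W ->
  wp inp do_task (fun c m' => c <= 60 /\ [/\
    at_point m' pos cur d s W (es ++
      emit d [:: Edge false (word_at W (arr m aNode s)) (word_at W cur)])
    & kept s m m']) m.
Proof.
move=> [mp mc md ms cW [mN mE mtrie mst]] tm nW.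
rewrite /do_task /=; do 2!step => /=.
apply: wp_if => /=; rewrite ms subn1 /= tm // => _.
apply: wp_if => /=; rewrite tm // => _.
rewrite /=; do 6!step => /=.
apply: wp_mono.
  apply: (@wp_add_edge _ pos cur d s W es false (arr m aNode s) cur);
    rewrite /= ?ms ?subn1 //=.
  by split=> //=; rewrite ?md ?subn1.
by move=> c m2 [c20 pm2 _ k12]; split; first by rewrite /=; lia.
Qed.

Lemma drop_cons pos x r : drop pos inp = x :: r ->
  onth inp pos = Some x /\ drop pos.+1 inp = r.
Proof.
move=> px; have := cat_take_drop pos inp; rewrite px => ix.
have sz : size (take pos inp) = pos.
  by apply: size_takel; have := congr1 size px; rewrite size_drop /=; lia.
split; first by rewrite -ix onth_cat sz ltnn subnn.
by rewrite -addn1 addnC -drop_drop px /= drop0.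
Qed.

Lemma drop_polish pos u r : drop pos inp = polish u ++ r ->
  drop (pos + complexity u) inp = r.
Proof.
by move=> pu; rewrite addnC -drop_drop pu drop_size_cat // size_polish.
Qed.

Lemma emit_cat d es es' : emit d (es ++ es') = emit d es ++ emit d es'.
Proof. by rewrite /emit; case: eqP. Qed.

Lemma wp_do_tasks m s Q : reg m rTasks = s.+1 ->
  wp inp do_task (fun k m' =>
    wp inp do_tasks (fun k' m'' => Q (4 + k + k') m'') m') m ->
  wp inp do_tasks Q m.
Proof. by move=> ms H; apply: wp_while_true => //=; rewrite ms. Qed.

Definition ext W W' : Prop := exists V, W' = W ++ V.

Lemma ext_trans W1 W2 W3 : ext W1 W2 -> ext W2 W3 -> ext W1 W3.
Proof. by move=> [V ->] [V' ->]; exists (V ++ V'); rewrite catA. Qed.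

Lemma ext_word W W' i : ext W W' -> i < size W ->
  i < size W' /\ word_at W' i = word_at W i.
Proof.
by move=> [V ->] iW; rewrite size_cat nth_cat iW; split=> //; exact: ltn_addr.
Qed.

Lemma kept_le s s' m m' : s <= s' -> kept s' m m' -> kept s m m'.
Proof. by move=> ss k j js; apply: k; exact: leq_trans ss. Qed.

Lemma kept_trans s m1 m2 m3 : kept s m1 m2 -> kept s m2 m3 -> kept s m1 m3.
Proof. by move=> k12 k23 j js; have [-> ->] := k23 j js; exact: k12. Qed.

(** The loop runs until the stack is empty, not until u has been read. The
    continuation therefore asks for the behaviour of the rest of the loop from
    the memory in which u has just been read, which lets the induction on u
    chain the factors of a product and the tasks that close a scope. The time
    bound charges one scan of the trie, of size at most L, to every symbol. *)
Lemma wp_tasks_term u L m pos cur d s W es r Q :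
  at_point m pos cur d s.+1 W es -> arr m aTask s = tTerm ->
  drop pos inp = polish u ++ r -> size W + complexity u <= L ->
  (forall k m' W' cur', k <= complexity u * (35 * L + 300) ->
     at_point m' (pos + complexity u) cur' d s W'
       (es ++ emit d (edges (word_at W cur) u)) ->
     kept s m m' -> word_at W' cur' = word_at W cur ++ content u ->
     ext W W' -> size W' <= size W + complexity u ->
     wp inp do_tasks (fun k' => Q (k + k')) m') ->
  wp inp do_tasks Q m.
Proof.
elim: u m pos cur d s W es r Q => [x||v IHv w IHw|v IHv|v IHv]
  m pos cur d s W es r Q pm tm /drop_cons[px pr] WL Qend /=;
  have cW := at_cur_node pm; apply: wp_do_tasks (at_tasks pm) _.
- apply: wp_mono (wp_task_letter pm tm px) _.
  move=> k m' [W' [cur' [kc [pm' km' wE W'E]]]]; apply: (Qend (4 + k) m' W' cur').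
  + by rewrite /= in WL *; lia.
  + by rewrite addn1.
  + by [].
  + by [].
  + case: W'E => ->; first by exists [::]; rewrite cats0.
    by rewrite -cats1; eexists.
  + by case: W'E => ->; rewrite ?size_rcons /= ?addn1.
- apply: wp_mono (wp_task_lam pm tm px) _.
  move=> k m' [kc [pm' km']]; apply: (Qend (4 + k) m' W cur).
  + by rewrite /= in WL *; lia.
  + by rewrite addn1.
  + by [].
  + by rewrite cats0.
  + by exists [::]; rewrite cats0.
  + by rewrite leq_addr.
- apply: wp_mono (wp_task_mul pm tm px) _.
  move=> k m1 [kc [pm1 km1 t1 t1']]; rewrite -[RHS]/((polish v ++ polish w) ++ r) -catA in pr.
  apply: (IHv _ _ _ _ _ _ _ _ _ pm1 t1' pr); first by rewrite /= in WL; lia.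
  move=> k2 m2 W2 cur2 k2c pm2 km2 c2E W2E W2s.
  have t2 : arr m2 aTask s = tTerm by have [->] := km2 s (ltnSn s).
  apply: (IHw _ _ _ _ _ _ _ _ _ pm2 t2 (drop_polish pr)).
    by rewrite /= in WL; lia.
  move=> k3 m3 W3 cur3 k3c pm3 km3 c3E W3E W3s.
  apply: wp_mono.
    apply: (Qend (4 + k + (k2 + k3)) m3 W3 cur3).
    + by rewrite /=; lia.
    + have -> : pos + complexity (Mul v w) = pos.+1 + complexity v + complexity w.
        by rewrite /=; lia.
      by rewrite /= emit_cat catA -c2E.
    + apply: kept_trans km1 (kept_trans _ km3); exact: kept_le km2.
    + by rewrite /= c3E c2E catA.
    + exact: ext_trans W3E.
    + by rewrite /=; lia.
  by move=> k' m'; rewrite !addnA.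
- apply: wp_mono (wp_task_plus pm tm px) _.
  move=> k m1 [kc [pm1 km1 t1 n1 t1']].
  apply: (IHv _ _ _ _ _ _ _ _ _ pm1 t1' pr); first by rewrite /= in WL; lia.
  move=> k2 m2 W2 cur2 k2c pm2 km2 c2E W2E W2s.
  have [t2 n2] := km2 s (ltnSn s); rewrite t1 n1 in t2 n2.
  have [cW2 cE2] := ext_word W2E cW.
  apply: wp_do_tasks (at_tasks pm2) _.
  apply: wp_mono; first by apply: (wp_task_exit_plus pm2 t2); rewrite n2.
  move=> k3 m3 [k3c [pm3 km3]]; apply: wp_mono.
    apply: (Qend (4 + k + (k2 + (4 + k3))) m3 W2 cur).
    + by rewrite /= in WL *; lia.
    + by rewrite n2 addSnnS in pm3; rewrite /= addn1.
    + by apply: kept_trans km1 (kept_trans _ km3); exact: kept_le km2.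
    + by rewrite /= cats0.
    + by [].
    + by rewrite /=; lia.
  by move=> k' m'; rewrite !addnA.
- apply: wp_mono (wp_task_max pm tm px) _.
  move=> k m1 [kc [pm1 km1 t1 n1 t1']].
  apply: (IHv _ _ _ _ _ _ _ _ _ pm1 t1' pr); first by rewrite /= in WL; lia.
  move=> k2 m2 W2 cur2 k2c pm2 km2 c2E W2E W2s.
  have [t2 n2] := km2 s (ltnSn s); rewrite t1 n1 in t2 n2.
  have [cW2 cE2] := ext_word W2E cW.
  apply: wp_do_tasks (at_tasks pm2) _.
  apply: wp_mono; first by apply: (wp_task_exit_max pm2 t2); rewrite n2.
  move=> k3 m3 [k3c [pm3 km3]]; apply: wp_mono.
    apply: (Qend (4 + k + (k2 + (4 + k3))) m3 W2 cur2).
    + by rewrite /= in WL *; lia.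
    + by rewrite n2 addSnnS cE2 c2E {1}/emit /= cats0 in pm3; rewrite /= addn1.
    + by apply: kept_trans km1 (kept_trans _ km3); exact: kept_le km2.
    + by [].
    + by [].
    + by rewrite /=; lia.
  by move=> k' m'; rewrite !addnA.
Qed.

Lemma wp_traverse u L m pos cur W es r :
  at_point m pos cur 0 0 W es -> drop pos inp = polish u ++ r ->
  size W + complexity u <= L ->
  wp inp traverse (fun k m' => exists W' cur',
    [/\ k <= complexity u * (35 * L + 300) + 20,
       at_point m' (pos + complexity u) cur' 0 0 W' (es ++ edges (word_at W cur) u),
       word_at W' cur' = word_at W cur ++ content u, ext W W'
     & size W' <= size W + complexity u]) m.
Proof.
move=> [mp mc md ms cW [mN mE mtrie mst]] pr WL.
rewrite /traverse /=; do 4!step => /=; rewrite ms.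
apply: (@wp_tasks_term u L _ pos cur 0 0 W es r _ _ _ pr WL) => //=.
move=> k m' W' cur' kc pm' _ wE WE Ws; apply: wp_while_false.
  by rewrite /= (at_tasks pm').
by exists W', cur'; split=> //=; lia.
Qed.

End Traversal.

(** * Marking the linked nodes *)

Section Marking.
Variables (X : Type) (W : seq (seq X)) (es G : seq (edge X)).
Variables (par let_ src dst str : nat -> nat) (lo hi : nat).
Variables (a T : nat).

(** The state of the sweep at node i and position j of the edge list: marks are
    sound for links from a, and every edge already visited from a marked source
    has done its work. The mark is a value T never used before, which saves
    clearing the marks between two sweeps. *)
Record marked (i j : nat) (f : nat -> nat) : Prop := Marked {
  marked_sound : forall d, f d = T -> d < size W /\ linked G (word_at W a) (word_at W d);
  marked_done : forall k, lo <= k < hi -> src k < i \/ src k = i /\ k < j ->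
    src k = a \/ f (src k) = T -> f (src k) = T /\ f (dst k) = T;
  marked_le : forall d, f d <= T
}.

Lemma marked_start f : (forall d, f d < T) -> marked 0 lo f.
Proof.
move=> fT; split=> [d fd|k kr [|[]]|d]; try by lia.
- by have := fT d; lia.
- exact: ltnW.
Qed.

Lemma marked_next i f : marked i hi f -> marked i.+1 lo f.
Proof.
move=> [snd dn le]; split=> // k kr ik; apply: dn => //; lia.
Qed.

Lemma marked_skip i j f : src j <> i -> marked i j f -> marked i j.+1 f.
Proof.
move=> ji [snd dn le]; split=> // k kr ik; apply: dn => //.
case: ik => [|[ki]]; first by left.
rewrite ltnS leq_eqVlt => /orP[/eqP kj|]; last by right.
by case: ji; rewrite -kj.
Qed.

Hypothesis W_trie : exists inp, trie inp W par let_.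
Hypothesis es_stored : stored W es src dst str.
Hypothesis hi_le : hi <= size es.
Hypothesis G_range : forall e, e \in G <-> exists2 j, lo <= j < hi & edge_at es j = e.
Hypothesis aW : a < size W.

Lemma range_edge k : lo <= k < hi ->
  [/\ src k < size W, dst k < size W &
    Edge (0 < str k) (word_at W (src k)) (word_at W (dst k)) \in G].
Proof.
move=> kr; have [|sW dW ek] := es_stored (j := k); first by lia.
by split=> //; apply/G_range; exists k.
Qed.

(** New marks fall on i or on later nodes because edges do not go back, so the
    edges of earlier nodes stay settled. The source i itself is marked as well,
    for the loop granted to the source of an edge. *)
Lemma marked_visit i j f : lo <= j < hi -> src j = i -> src j <= dst j ->
  marked i j f ->
  let f1 := if i == a then upd f i T else f in
  let f2 := if f1 i == T then upd f1 (dst j) T else f1 in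
  marked i j.+1 f2.
Proof.
move=> jr ji jd [snd dn le] f1; have [sW dW ek] := range_edge jr.
have f1E k : f1 k = T <-> k = i /\ i = a \/ f k = T.
  by rewrite /f1 /upd; case: (i =P a) => ia; [case: (k =P i) => ki|]; intuition.
have le1 d : f1 d <= T by rewrite /f1 /upd; case: ifP => // _; case: ifP.
have snd1 d : f1 d = T -> d < size W /\ linked G (word_at W a) (word_at W d).
  move=> /f1E[[-> ia]|/snd //]; rewrite -ji in ia *; rewrite sW; split=> //.
  by rewrite ia; apply: linked_refl; rewrite -ia; exact: ek.
move=> f2; have f2E k : f2 k = T <-> f1 k = T \/ k = dst j /\ f1 i = T.
  by rewrite /f2 /upd; case: (f1 i =P T) => fi; [case: (k =P dst j) => kd|];
    intuition.
split.
- move=> d /f2E[/snd1 //|[-> /snd1[_ ai]]]; split=> //.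
  by apply: linked_trans ai _; rewrite -ji; exact: linked_edge ek.
- move=> k kr ik ka.
  have [kj|kj] := eqVneq k j.
    rewrite kj ji in ka *.
    have fi : f1 i = T.
      case: ka => [ia|/f2E[//|[] //]]; apply/f1E; left; by split.
    by split; apply/f2E; [left|right].
  have ik' : src k < i \/ src k = i /\ k < j.
    by case: ik => [|[? kj']]; [left|right; split=> //; move: kj kj'; lia].
  have fk : src k = a \/ f (src k) = T.
    have ij : src k = dst j -> src k = i by case: ik' => [|[]]; lia.
    case: ka => [|/f2E[/f1E[[ki ia]|]|[/ij ki /f1E[[_ ia]|fi]]]]; try by [left|right].
    - by left; rewrite ki.
    - by left; rewrite ki.
    - by right; rewrite ki.
  have [fs fd] := dn k kr ik' fk.
  by split; apply/f2E; left; apply/f1E; right.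
- by move=> d; rewrite /f2 /upd; case: ifP => // _; case: ifP.
Qed.

(** Once every edge is settled the marks contain all links, by induction on
    [linked]. *)
Lemma marked_end f b : marked (size W) lo f -> b < size W ->
  (f b = T <-> linked G (word_at W a) (word_at W b)).
Proof.
move=> [snd dn le] bW; split=> [/snd[] //|ab].
have [inp [_ _ inj _]] := W_trie.
have dn' k : lo <= k < hi -> src k = a \/ f (src k) = T ->
    f (src k) = T /\ f (dst k) = T.
  by move=> kr; apply: dn => //; left; have [] := range_edge kr.
have closed w w' : linked G w w' -> forall i, i < size W -> word_at W i = w ->
    i = a \/ f i = T -> exists i', [/\ i' < size W, word_at W i' = w' & f i' = T].
  elim=> {w w'} [k w w' /G_range[j jr]|k w w' /G_range[j jr]|w1 w2 w3 _ IH1 _ IH2].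
  - have [|sW dW ->] := es_stored (j := j); first by lia.
    move=> [_ <- <-] i iW /inj -> // /(dn' _ jr)[_ fd]; by exists (dst j).
  - have [|sW dW ->] := es_stored (j := j); first by lia.
    move=> [_ <- _] i iW /inj -> // /(dn' _ jr)[fs _]; by exists (src j).
  - move=> i iW iw /(IH1 _ iW iw)[i2 [i2W i2w fi2]].
    by apply: (IH2 i2) => //; right.
have [|i [iW iw fi]] := closed _ _ ab a aW erefl; first by left.
by rewrite -(inj _ _ iW bW iw).
Qed.

End Marking.

(** * The comparison program *)

Definition mark_linked : program :=
  for_loop rI (Const 0) rNodes
    (for_loop rJ (Reg rLo2) rHi2
      (If (equal (Arr aSrc (Reg rJ)) (Reg rI))
        (block
          [:: If (equal (Reg rI) (Reg rSrc)) (SetArr aMark (Reg rI) (Reg rStamp)) Skip;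
              If (equal (Arr aMark (Reg rI)) (Reg rStamp))
                (SetArr aMark (Arr aDst (Reg rJ)) (Reg rStamp)) Skip])
        Skip)).

Definition find_strong : program :=
  for_loop rJ (Reg rLo2) rHi2
    (If (And (equal (Arr aSrc (Reg rJ)) (Reg rSrc))
          (And (equal (Arr aDst (Reg rJ)) (Reg rDst))
             (Leq (Const 1) (Arr aStrong (Reg rJ)))))
      (SetReg rFlag (Const 1)) Skip).

(** The flag starts true for a weak edge, which then needs no strong
    counterpart. *)
Definition check_edge : program := block
  [:: incr rStamp;
      SetReg rSrc (Arr aSrc (Reg rQuery));
      SetReg rDst (Arr aDst (Reg rQuery));
      SetReg rFlag (Sub (Const 1) (Arr aStrong (Reg rQuery)));
      mark_linked;
      find_strong;
      If (And (equal (Arr aMark (Reg rDst)) (Reg rStamp)) (Leq (Const 1) (Reg rFlag)))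
        Skip (SetReg rAns (Const 0))].

Definition check_covered : program :=
  for_loop rQuery (Reg rLo1) rHi1 check_edge.

(** * Correctness of the comparison *)

Section Checking.
Variables (X : Type) (inp : seq (symbol X)).
Implicit Types (m : memory) (W : seq (seq X)) (es G : seq (edge X)).

Definition agree (l : seq nat) m m' : Prop :=
  (forall a, a != aMark -> arr m' a = arr m a) /\
  (forall r, r \notin l -> reg m' r = reg m r).

Lemma agree_trans l m1 m2 m3 : agree l m1 m2 -> agree l m2 m3 -> agree l m1 m3.
Proof.
move=> [a12 r12] [a23 r23]; split=> [a am|r rl]; first by rewrite a23 ?a12.
by rewrite r23 ?r12.
Qed.

Lemma agree_set l m r x : r \in l -> agree l m (set_reg m r x).
Proof. by move=> rl; split=> //= s; case: eqP => // ->; rewrite rl. Qed.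

Lemma agree_mark l m i x : agree l m (set_arr m aMark i x).
Proof.
by split=> // a am; apply/funext => j /=; rewrite (negPf am).
Qed.

Lemma agree_sub l l' m m' : {subset l <= l'} -> agree l m m' -> agree l' m m'.
Proof.
by move=> ll [aa rr]; split=> // r rl; apply: rr; apply: contra rl; exact: ll.
Qed.

Lemma agree_represents l m m' W es : rNodes \notin l -> rEdges \notin l ->
  agree l m m' -> represents inp m W es -> represents inp m' W es.
Proof.
by move=> n3 n4 [aa rr] [mN mE mT mS]; split; rewrite ?rr ?aa.
Qed.

Lemma equalP m e1 e2 : test_holds inp m (equal e1 e2) <->
  expr_val m e1 = expr_val m e2.
Proof. by rewrite /=; lia. Qed.

Definition range es lo hi G : Prop :=
  forall e, e \in G <-> exists2 j, lo <= j < hi & edge_at es j = e.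

Lemma wp_mark_linked m W es G a b lo hi Y Q :
  represents inp m W es -> (forall j, j < size es -> arr m aSrc j <= arr m aDst j) ->
  hi <= size es -> lo <= hi -> range es lo hi G ->
  reg m rLo2 = lo -> reg m rHi2 = hi -> reg m rSrc = a -> a < size W ->
  b < size W ->
  (forall d, arr m aMark d < reg m rStamp) ->
  size W <= Y -> size es <= Y -> 0 < Y ->
  (forall k m', k <= 110 * (Y * Y) -> agree [:: rI; rJ] m m' ->
     (forall d, arr m' aMark d <= reg m' rStamp) ->
     (arr m' aMark b = reg m' rStamp <-> linked G (word_at W a) (word_at W b)) ->
     Q k m') ->
  wp inp mark_linked Q m.
Proof.
move=> [mN mE mT mS] mono hE lohi rG mlo mhi ma aW bW fresh WY eY Y0 Qend.
set T := reg m rStamp in fresh.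
set src := arr m aSrc in mono mS; set dst := arr m aDst in mono mS.
pose inv i j m' := agree [:: rI; rJ] m m' /\
  marked W G src dst lo hi a T i j (arr m' aMark).
apply: (@wp_for _ _ _ _ _ _ (fun i m' => inv i lo m') (90 * Y) (size W)) => //=.
- split; first exact: agree_set.
  exact: marked_start.
- move=> i m1 iW m1i m1N [ag1 mk1].
  have [aa1 rr1] := ag1.
  apply: (@wp_for _ _ _ _ _ _ (fun j m' => inv i j m' /\ reg m' rI = i) 70 hi) => //=.
  + by rewrite rr1 // mlo.
  + by rewrite rr1.
  + rewrite rr1 // mlo; split=> //; split=> //.
    by apply: agree_trans ag1 _; exact: agree_set.
  + move=> j m2 jr m2j m2h [[ag2 mk2] m2i]; have [aa2 rr2] := ag2.
    rewrite rr1 // mlo in jr.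
    have j_es : j < size es by lia.
    have m2N : reg m2 rNodes = size W by rewrite rr2.
    have m2T : reg m2 rStamp = T by rewrite rr2.
    have m2a : reg m2 rSrc = a by rewrite rr2.
    apply: wp_if => /equalP /=; rewrite m2j m2i aa2 // -/src => sij.
      have := marked_visit mS hE rG aW jr sij (mono j j_es) mk2.
      set f1 := if i == a then _ else _.
      (* the memory between the two conditional marks *)
      pose Q1 k m' := [/\ k <= 30, arr m' aMark = f1, agree [:: rI; rJ] m m',
        reg m' rI = i & reg m' rJ = j].
      move=> /= mkf; step; apply: (@wp_mono _ _ _ Q1).
        apply: wp_if => /equalP /=; rewrite m2i m2a => ia; step => /=; split=> //=.
        * by rewrite m2i m2T /f1 ia eqxx.
        * by apply: agree_trans ag2 _; exact: agree_mark.
        * by rewrite /f1; case: eqP.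
      move=> k m3 [k30 m3f ag3 m3i m3j]; have [aa3 rr3] := ag3.
      have m3T : reg m3 rStamp = T by rewrite rr3.
      have m3h : reg m3 rHi2 = hi by rewrite rr3.
      have m3N : reg m3 rNodes = size W by rewrite rr3.
      apply: wp_if => /equalP /=; rewrite m3f m3i m3T => fi; step => /=; split=> //=; try lia.
      * split=> //; split.
          apply: agree_trans ag3 _; apply: agree_trans (agree_mark _ _ _ _) _.
          exact: agree_set.
        rewrite /= m3f m3j m3T aa3 // -/dst; move: mkf; rewrite fi eqxx; exact.
      * split=> //; split.
          by apply: agree_trans ag3 _; exact: agree_set.
        by rewrite /= m3f; move: mkf; case: eqP.
    step => /=; split=> //; split=> //; split.
      by apply: agree_trans ag2 _; exact: agree_set.
    exact: marked_skip.
  + move=> k m2 kc _ [[ag2 mk2] m2i]; have [aa2 rr2] := ag2; split=> //.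
    * move: kc; rewrite rr1 // mlo; have : hi - lo <= Y by lia.
      move: (hi - lo) => h hY; have := leq_mul hY (leqnn 80); lia.
    * by rewrite rr2.
    * split; first by apply: agree_trans ag2 _; exact: agree_set.
      exact: marked_next.
- move=> k m1 kc _ [[aa1 rr1] mk1]; apply: Qend => //.
  + move: kc; rewrite subn0; have := leq_mul WY (leqnn (90 * Y + 10)).
    have : Y <= Y * Y by rewrite leq_pmulr.
    by lia.
  + by move=> d; rewrite rr1 //; apply: (marked_le mk1).
  + have W_trie : exists inp, trie inp W (arr m aParent) (arr m aLetter) by exists inp.
    by rewrite rr1 //; exact: (marked_end W_trie mS hE rG aW mk1 bW).
Qed.

Lemma wp_find_strong m lo hi a b Y Q :
  lo <= hi -> hi <= Y -> 0 < Y -> reg m rLo2 = lo -> reg m rHi2 = hi ->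
  reg m rSrc = a -> reg m rDst = b ->
  (forall k m', k <= 70 * Y -> agree [:: rJ; rFlag] m m' ->
     arr m' = arr m ->
     (0 < reg m' rFlag <-> 0 < reg m rFlag \/ exists2 j, lo <= j < hi &
        [/\ arr m aSrc j = a, arr m aDst j = b & 0 < arr m aStrong j]) ->
     Q k m') ->
  wp inp find_strong Q m.
Proof.
move=> lohi hY Y0 mlo mhi ma mb Qend.
apply: (@wp_for _ _ _ _ _ _ (fun i m' => [/\ agree [:: rJ; rFlag] m m',
   arr m' = arr m & 0 < reg m' rFlag <-> 0 < reg m rFlag \/ exists2 j, lo <= j < i &
   [/\ arr m aSrc j = a, arr m aDst j = b & 0 < arr m aStrong j]]) 50 hi) => //=.
- by rewrite mlo.
- split=> //; first exact: agree_set.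
  by split=> [|[//|[j]]]; [left|rewrite mlo; lia].
- rewrite mlo => i m1 ir m1j m1h [[aa1 rr1] am1 fl].
  have m1a : reg m1 rSrc = a by rewrite rr1.
  have m1b : reg m1 rDst = b by rewrite rr1.
  have hitE : test_holds inp m1 (And (equal (Arr aSrc (Reg rJ)) (Reg rSrc))
          (And (equal (Arr aDst (Reg rJ)) (Reg rDst))
             (Leq (Const 1) (Arr aStrong (Reg rJ))))) <->
     [/\ arr m aSrc i = a, arr m aDst i = b & 0 < arr m aStrong i].
    by rewrite /= m1j m1a m1b am1; split=> [|[-> -> ->]]; [split; lia|rewrite !leqnn].
  have ir' j : lo <= j < i.+1 -> lo <= j < i \/ j = i by lia.
  apply: wp_if => /hitE hit; step => /=; split=> //; split=> //.
  + split=> // r rl /=; move: (rl); rewrite !inE !negb_or => /andP[/negPf -> /negPf ->].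
    exact: rr1.
  + by split=> // _; right; exists i => //; lia.
  + split=> // r rl /=; move: (rl); rewrite !inE !negb_or => /andP[/negPf -> _].
    exact: rr1.
  + apply: (iff_trans fl); split=> -[?|[j jr ?]]; try by left.
      by right; exists j => //; lia.
    by have [?|ji] := ir' j jr; [right; exists j|case: hit; rewrite -ji].
- move=> k m1 kc _ [ag1 am1 fl]; apply: Qend => //.
  by move: kc; rewrite mlo; lia.
Qed.

Definition edge_holds G (e : edge X) : Prop :=
  (strong e -> Edge true (source e) (target e) \in G) /\
  linked G (source e) (target e).

Lemma wp_check_edge m W es G q lo hi Y :
  represents inp m W es ->
  (forall j, j < size es -> arr m aSrc j <= arr m aDst j) ->
  hi <= size es -> lo <= hi -> range es lo hi G ->
  reg m rLo2 = lo -> reg m rHi2 = hi -> reg m rQuery = q -> q < size es ->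
  (forall d, arr m aMark d <= reg m rStamp) ->
  size W <= Y -> size es <= Y -> 0 < Y ->
  wp inp check_edge (fun k m' => [/\ k <= 250 * (Y * Y),
     agree [:: rAns; rSrc; rDst; rI; rJ; rStamp; rFlag] m m',
     forall d, arr m' aMark d <= reg m' rStamp,
     edge_holds G (edge_at es q) -> reg m' rAns = reg m rAns
   & ~ edge_holds G (edge_at es q) -> reg m' rAns = 0]) m.
Proof.
move=> mr mono hE lohi rG mlo mhi mq qE fresh WY eY Y0.
have [mN mE mT mS] := mr; have [aW bW eq_] := mS q qE.
have [_ _ inj _] := mT.
pose a := arr m aSrc q; pose b := arr m aDst q.
rewrite /check_edge /=; do 8!step => /=; rewrite mq.
set m1 := set_reg _ rFlag _.
pose l := [:: rAns; rSrc; rDst; rI; rJ; rStamp; rFlag].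
have ag1 : agree l m m1.
  by do 4!(apply: agree_trans; last exact: agree_set).
have am1 : arr m1 = arr m by [].
have ans1 : reg m1 rAns = reg m rAns by [].
have [m1a m1b m1T m1f] : [/\ reg m1 rSrc = a, reg m1 rDst = b,
  reg m1 rStamp = (reg m rStamp).+1 & reg m1 rFlag = 1 - arr m aStrong q].
  by rewrite /m1 /= addn1.
clearbody m1; step.
have mr1 := agree_represents _ _ ag1 mr.
apply: (wp_mark_linked (a := a) (b := b) (mr1 isT isT) _ hE lohi rG _ _ _ aW bW _ WY eY Y0);
  rewrite ?am1 ?m1T //; try by have [_ ->] := ag1.
move=> k2 m2 k2c ag2 fresh2 markb.
have ag2' := ag2; have {}ag2 : agree l m1 m2 by apply: agree_sub ag2 => r;
  rewrite !inE => /orP[] /eqP ->.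
have ag02 := agree_trans ag1 ag2; have [aa2 rr2] := ag02.
have [m2a m2b m2f m2T] : [/\ reg m2 rSrc = a, reg m2 rDst = b,
   reg m2 rFlag = 1 - arr m aStrong q & reg m2 rStamp = (reg m rStamp).+1].
  by have [_ r12] := ag2'; rewrite !r12.
step; apply: (wp_find_strong lohi (leq_trans hE eY) Y0 _ _ m2a m2b);
  try by rewrite rr2.
move=> k3 m3 k3c ag3 am3 flag3.
have strongE : (exists2 j, lo <= j < hi &
    [/\ arr m2 aSrc j = a, arr m2 aDst j = b & 0 < arr m2 aStrong j]) <->
    Edge true (word_at W a) (word_at W b) \in G.
  rewrite !aa2 //; split=> [[j jr [sj dj kj]]|/rG[j jr]].
    have [|_ _ ej] := mS j; first by lia.
    by apply/rG; exists j => //; rewrite ej sj dj kj.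
  have [|sW dW ->] := mS j; first by lia.
  move=> [kj /inj sa /inj db]; exists j => //.
  by split; [exact: sa|exact: db|].
have okE : edge_holds G (edge_at es q) <->
    arr m3 aMark (reg m3 rDst) = reg m3 rStamp /\ 0 < reg m3 rFlag.
  have [_ r23] := ag3; rewrite flag3 strongE am3 !r23 // m2b markb eq_ m2f.
  rewrite /edge_holds /= -/a -/b; case: (posnP (arr m aStrong q)) => [->|st].
    by split=> [[_ ?]|[? _]]; split=> //; left.
  have -> : 1 - arr m aStrong q = 0 by lia.
  by split=> [[/(_ isT)]|[? []]]; split=> //; right.
have ag3' := ag3; have {}ag3 : agree l m2 m3 by apply: agree_sub ag3 => r;
  rewrite !inE => /orP[] /eqP ->.
have ag03 := agree_trans ag02 ag3.
have fresh3 d : arr m3 aMark d <= reg m3 rStamp.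
  by have [_ r23] := ag3'; rewrite am3 r23.
have Y1 : Y <= Y * Y by rewrite leq_pmulr.
have ans3 : reg m3 rAns = reg m rAns.
  by have [_ r23] := ag3'; have [_ r12] := ag2'; rewrite r23 // r12.
have testE : test_holds inp m3 (And (equal (Arr aMark (Reg rDst)) (Reg rStamp))
     (Leq (Const 1) (Reg rFlag))) <-> edge_holds G (edge_at es q).
  by rewrite okE /=; split=> [[]|[-> ->]]; [lia|rewrite leqnn].
apply: wp_if => /testE ok; step; split=> //=; try lia.
by apply: agree_trans ag03 _; exact: agree_set.
Qed.

Lemma wp_check_covered m W es G H lo1 hi1 lo hi Y :
  represents inp m W es ->
  (forall j, j < size es -> arr m aSrc j <= arr m aDst j) ->
  hi <= size es -> lo <= hi -> range es lo hi H ->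
  hi1 <= size es -> lo1 <= hi1 -> range es lo1 hi1 G ->
  reg m rLo1 = lo1 -> reg m rHi1 = hi1 ->
  reg m rLo2 = lo -> reg m rHi2 = hi ->
  (forall d, arr m aMark d <= reg m rStamp) ->
  size W <= Y -> size es <= Y -> 0 < Y ->
  wp inp check_covered (fun k m' => [/\ k <= 270 * Y ^ 3,
     agree [:: rQuery; rAns; rSrc; rDst; rI; rJ; rStamp; rFlag] m m',
     forall d, arr m' aMark d <= reg m' rStamp,
     covered G H -> reg m' rAns = reg m rAns
   & ~ covered G H -> reg m' rAns = 0]) m.
Proof.
move=> mr mono hE lohi rH hE1 lohi1 rG ml1 mh1 ml mh fresh WY eY Y0.
pose l := [:: rQuery; rAns; rSrc; rDst; rI; rJ; rStamp; rFlag].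
pose ok i := forall j, lo1 <= j < i -> edge_holds H (edge_at es j).
apply: (@wp_for _ _ _ _ _ _ (fun i m' => [/\ agree l m m',
   forall d, arr m' aMark d <= reg m' rStamp,
   ok i -> reg m' rAns = reg m rAns & ~ ok i -> reg m' rAns = 0])
   (250 * (Y * Y)) hi1) => //=.
- by rewrite ml1.
- rewrite ml1; split=> //; first exact: agree_set.
  by case=> j; lia.
- rewrite ml1 => i m1 ir m1q m1h [ag1 fresh1 ok1 nok1]; have [aa1 rr1] := ag1.
  have mr1 := agree_represents (l := l) isT isT ag1 mr.
  apply: wp_mono (wp_check_edge mr1 _ hE lohi rH _ _ m1q _ fresh1 WY eY Y0) _;
    try by rewrite ?aa1 ?rr1.
    by lia.
  move=> k m2 [kc ag2 fresh2 ok2 nok2]; have [aa2 rr2] := ag2.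
  have okS : ok i.+1 <-> ok i /\ edge_holds H (edge_at es i).
    split=> [oki|[oki ei] j jr]; first by split=> [j jr|]; apply: oki; lia.
    by case: (ltngtP j i) => [ji|ji|->] //; [apply: oki|]; lia.
  split=> //; try by rewrite rr2.
  split=> //=.
  + apply: agree_trans ag1 _; apply: agree_trans _ (agree_set _ _ _) => //.
    by apply: agree_sub ag2 => r rl; rewrite inE rl orbT.
  + by move=> /okS[oki ei]; rewrite ok2 // ok1.
  + move=> nok; case: (pselect (edge_holds H (edge_at es i))) => ei; last exact: nok2.
    by rewrite (ok2 ei); apply: nok1 => oki; apply: nok; apply/okS.
- move=> k m1 kc _ [ag1 fresh1 ok1 nok1].
  have covE : covered G H <-> ok hi1.
    split=> [cov j jr|oki k' s t /rG[j jr ej]].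
      have : edge_at es j \in G by apply/rG; exists j.
      case ej: (edge_at es j) => [k' s t] /cov; exact.
    by have := oki j jr; rewrite ej.
  split=> //; last 2 first.
  + by move=> /covE.
  + by move=> nc; apply: nok1 => /covE.
  move: kc; rewrite ml1; have hY : hi1 - lo1 <= Y by lia.
  have := leq_mul hY (leqnn (250 * (Y * Y) + 10)); rewrite !expnS expn0 muln1.
  have Y1 : Y <= Y * Y by rewrite leq_pmulr.
  have Y2 : Y * Y <= Y * (Y * Y) by rewrite leq_pmull.
  by nia.
Qed.

End Checking.

(** * The decision procedure *)

Fixpoint writes_reg (r : nat) (p : program) : bool :=
  match p with
  | Skip | SetArr _ _ _ => false
  | SetReg s _ => s == r
  | Seq p1 p2 | If _ p1 p2 => writes_reg r p1 || writes_reg r p2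
  | While _ p1 => writes_reg r p1
  end.

Fixpoint writes_arr (a : nat) (p : program) : bool :=
  match p with
  | Skip | SetReg _ _ => false
  | SetArr b _ _ => b == a
  | Seq p1 p2 | If _ p1 p2 => writes_arr a p1 || writes_arr a p2
  | While _ p1 => writes_arr a p1
  end.

Section Main.
Variables (X : Type) (inp : seq (symbol X)).

Lemma exec_writes_reg p m k m' r : exec inp p m k m' ->
  ~~ writes_reg r p -> reg m' r = reg m r.
Proof.
elim=> {p m k m'} //=.
- by move=> s e m; rewrite eq_sym => /negPf ->.
- by move=> p1 p2 m1 m2 m3 k1 k2 _ IH1 _ IH2; rewrite negb_or => /andP[/IH1 <- /IH2].
- by move=> t p1 p2 m m' k _ _ IH; rewrite negb_or => /andP[/IH].
- by move=> t p1 p2 m m' k _ _ IH; rewrite negb_or => /andP[_ /IH].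
- by move=> t p m1 m2 m3 k1 k2 _ _ IH1 _ IH2 w; rewrite IH2 ?IH1.
Qed.

Lemma exec_writes_arr p m k m' a : exec inp p m k m' ->
  ~~ writes_arr a p -> arr m' a = arr m a.
Proof.
elim=> {p m k m'} //=.
- by move=> s e1 e2 m sa; apply/funext => j; rewrite eq_sym (negPf sa).
- by move=> p1 p2 m1 m2 m3 k1 k2 _ IH1 _ IH2; rewrite negb_or => /andP[/IH1 <- /IH2].
- by move=> t p1 p2 m m' k _ _ IH; rewrite negb_or => /andP[/IH].
- by move=> t p1 p2 m m' k _ _ IH; rewrite negb_or => /andP[_ /IH].
- by move=> t p m1 m2 m3 k1 k2 _ _ IH1 _ IH2 w; rewrite IH2 ?IH1.
Qed.

(** Registers and arrays that a program text does not mention as destinations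
    survive, which carries data across the calls of [traverse]. *)
Lemma wp_frame p Q m : wp inp p Q m -> wp inp p (fun k m' => [/\ Q k m',
    forall r, ~~ writes_reg r p -> reg m' r = reg m r
  & forall a, ~~ writes_arr a p -> arr m' a = arr m a]) m.
Proof.
move=> [k [m' [ex Qm]]]; exists k, m'; split=> //; split=> // [r|a].
  exact: exec_writes_reg ex.
exact: exec_writes_arr ex.
Qed.

Lemma range_l (G H : seq (edge X)) : range (G ++ H) 0 (size G) G.
Proof.
move=> e; split=> [/(nthP (Edge false [::] [::]))[j jG <-]|[j jG <-]].
  by exists j; rewrite // nth_cat jG.
by rewrite /= in jG; rewrite nth_cat jG mem_nth.
Qed.

Lemma range_r (G H : seq (edge X)) : range (G ++ H) (size G) (size (G ++ H)) H.
Proof.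
move=> e; rewrite size_cat; split=> [/(nthP (Edge false [::] [::]))[j jH <-]|[j jG <-]].
  exists (size G + j); first by rewrite leq_addr ltn_add2l.
  by rewrite nth_cat ltnNge leq_addr addKn.
by case/andP: jG => Gj jH; rewrite nth_cat ltnNge Gj /= mem_nth // ltn_subLR.
Qed.

End Main.

Definition word_problem : program := block
  [:: SetReg rNodes (Const 1);
      traverse;
      SetReg rEnd (Reg rCur);
      SetReg rSplit (Reg rEdges);
      SetReg rCur (Const 0);
      traverse;
      If (equal (Reg rEnd) (Reg rCur)) (SetReg rAns (Const 1)) Skip;
      SetReg rLo1 (Const 0); SetReg rHi1 (Reg rSplit);
      SetReg rLo2 (Reg rSplit); SetReg rHi2 (Reg rEdges);
      check_covered;
      SetReg rLo1 (Reg rSplit); SetReg rHi1 (Reg rEdges);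
      SetReg rLo2 (Const 0); SetReg rHi2 (Reg rSplit);
      check_covered].

Section Decision.
Variable X : Type.

Lemma wp_word_problem (u v : term X) :
  wp (polish u ++ polish v) word_problem (fun k m' =>
    k <= 150 * 120 * maxn (complexity u) (complexity v) ^ 3 /\
    ((same_value (u, v) /\ reg m' rAns = 1) \/
     (~ same_value (u, v) /\ reg m' rAns = 0))) init_memory.
Proof.
set inp := polish u ++ polish v.
set n := maxn _ _.
have [un vn] : complexity u <= n /\ complexity v <= n.
  by rewrite leq_maxl leq_maxr.
have n0 : 0 < n by apply: leq_trans un; case: (u) => *; rewrite /= ?addn1.
pose L := 1 + complexity u + complexity v.
rewrite /word_problem /=; do 3!step => /=.
set m0 := set_reg _ _ _.
have pm0 : at_point inp m0 0 0 0 0 [:: [::]] [::].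
  split=> //=; split=> //=.
  by split=> //= [[|i] [|j]|[|[]]].
have d0 : drop 0 inp = polish u ++ polish v by rewrite drop0.
apply: wp_mono (wp_frame (wp_traverse (L := L) pm0 d0 _)) _; first by rewrite /L /=; lia.
move=> k1 m1 [[W1 [c1 [k1c pm1 c1E W1E W1s]]] rr1 aa1].
have ans1 : reg m1 rAns = 0 by rewrite rr1.
have st1 : reg m1 rStamp = 0 by rewrite rr1.
have mk1 : arr m1 aMark = fun=> 0 by rewrite aa1.
move: pm1; rewrite /= => pm1; have [m1p m1c m1d m1s c1W mr1] := pm1.
have [W1_gt0 W10] : 0 < size W1 /\ word_at W1 0 = [::].
  by have [] := ext_word W1E (ltn0Sn 0).
have m1E : reg m1 rEdges = size (edges [::] u) by have [_ ->] := mr1.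
do 7!step => /=; rewrite m1c m1E.
set m1' := set_reg _ _ _.
have pm1' : at_point inp m1' (complexity u) 0 0 0 W1 (edges [::] u).
  by case: mr1 => *; split=> //=.
have d1 : drop (complexity u) inp = polish v ++ [::].
  by rewrite cats0 -[complexity u]add0n; apply: drop_polish d0.
apply: wp_mono (wp_frame (wp_traverse (L := L) pm1' d1 _)) _.
  by rewrite /L; move: W1s => /=; lia.
move=> k2 m2 [[W2 [c2 [k2c pm2 c2E W2E W2s]]] rr2 aa2].
have ans2 : reg m2 rAns = 0 by rewrite rr2.
have st2 : reg m2 rStamp = 0 by rewrite rr2.
have end2 : reg m2 rEnd = c1 by rewrite rr2.
have split2 : reg m2 rSplit = size (edges [::] u) by rewrite rr2.
have mk2 : arr m2 aMark = fun=> 0 by rewrite aa2.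
rewrite W10 in pm2 c2E; have [m2p m2c m2d m2s c2W mr2] := pm2.
set es := edges [::] u ++ edges [::] v in pm2 mr2.
have [m2N m2E m2T m2S] := mr2.
have [c1W2 c1E2] := ext_word W2E c1W.
have endE : c1 = c2 <-> content u = content v.
  rewrite /= in c1E c2E; rewrite -c1E -c2E -c1E2; split=> [-> //|].
  by case: m2T => _ _ inj _; apply: inj.
have mono2 j : j < size es -> arr m2 aSrc j <= arr m2 aDst j.
  move=> jes; have [sW dW ej] := m2S _ jes.
  have : edge_at es j \in es by exact: mem_nth.
  rewrite {1}ej mem_cat => /orP[] /edges_target[c [cE _]]; exact: trie_le m2T sW dW cE.
have Ws : size W2 <= 3 * n by move: W1s W2s => /=; lia.
have Es : size es <= 3 * n.
  by rewrite size_cat; have := size_edges [::] u; have := size_edges [::] v; lia.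
have Y0 : 0 < 3 * n by lia.
have uE : size (edges [::] u) <= size es by rewrite size_cat leq_addr.
step; apply: (@wp_mono _ _ _ (fun k m' => [/\ k <= 20,
   forall r, r != rAns -> reg m' r = reg m2 r, arr m' = arr m2 &
   (content u = content v /\ reg m' rAns = 1) \/
   (content u <> content v /\ reg m' rAns = 0)])).
  apply: wp_if => /equalP /=; rewrite end2 m2c endE => uv; step => /=; split=> //.
  + by move=> r /negPf ->.
  + by left.
  + by right.
move=> k3 m3 [k3c rr3 aa3 ans3].
have mr3 : represents inp m3 W2 es by split; rewrite ?aa3 ?rr3.
do 9!step => /=; rewrite !rr3 // split2 m2E.
set m4 := set_reg _ rHi2 _.
have mr4 : represents inp m4 W2 es by case: mr3 => *; split.
apply: wp_mono (wp_check_covered (m := m4) (Y := 3 * n) mr4 _ _ _ (range_r _ _) _ _ (range_l _ _)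
  _ _ _ _ _ Ws Es Y0) _ => //=; rewrite ?aa3 ?mk2 //; try by rewrite rr3 // st2.
move=> k5 m5 [k5c [aa5 rr5] fresh5 cov5 ncov5].
have mr5 : represents inp m5 W2 es.
  by apply: agree_represents (conj aa5 rr5) mr4.
do 8!step => /=; rewrite !rr5 //= !rr3 // split2 m2E.
set m6 := set_reg _ rHi2 _.
have mr6 : represents inp m6 W2 es by case: mr5 => *; split.
apply: wp_mono (wp_check_covered (m := m6) (Y := 3 * n) mr6 _ _ _ (range_l _ _) _ _ (range_r _ _)
  _ _ _ _ _ Ws Es Y0) _ => //=; rewrite ?aa5 ?aa3 //.
move=> k7 m7 [k7c _ _ cov7 ncov7]; split.
  have k1c' : k1 <= n * (105 * n + 335) + 20.
    apply: leq_trans k1c _; rewrite leq_add2r; apply: leq_mul => //.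
    by rewrite /L; lia.
  have k2c' : k2 <= n * (105 * n + 335) + 20.
    apply: leq_trans k2c _; rewrite leq_add2r; apply: leq_mul => //.
    by rewrite /L; lia.
  have nn : n <= n * n by rewrite leq_pmulr.
  have nnn : n * n <= n * (n * n) by rewrite leq_pmull.
  have Y3 : (3 * n) ^ 3 = 27 * n ^ 3 by rewrite expnMn.
  have n3 : n * (n * n) = n ^ 3 by rewrite !expnS expn0 muln1.
  have n2 : n * (105 * n + 335) = 105 * (n * n) + 335 * n.
    by rewrite mulnDr mulnCA [n * 335]mulnC.
  rewrite n2 in k1c' k2c'; rewrite Y3 in k5c k7c; rewrite n3 in nnn.
  move: (n ^ 3) (n * n) k1c' k2c' k5c k7c nn nnn => N3 N2.
  by clear - n0 k3c; lia.
have [uv|nuv] := pselect (covered (edges [::] u) (edges [::] v)); last first.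
  have r5 := ncov5 nuv; right; split; first by move=> /same_valueE[].
  by have [vu|/ncov7 //] := pselect (covered (edges [::] v) (edges [::] u));
    rewrite cov7.
have [vu|nvu] := pselect (covered (edges [::] v) (edges [::] u)); last first.
  by right; split; [move=> /same_valueE[]|exact: ncov7].
case: ans3 => [[cuv r3]|[cuv r3]]; [left|right].
  by split; [exact/same_valueE|rewrite cov7 // cov5].
by split; [move=> /same_valueE[]|rewrite cov7 // cov5].
Qed.

End Decision.

Theorem theorem4p11 (X : Type) (X_nonempty : inhabited X) :
  decidable_in_time_O (@word_problem_input X) (@word_problem_size X)
    (@same_value X) (fun n => n ^ 3).
Proof.
(* The trie and the edge list have at most 3 n entries, so each of the two
   comparisons takes at most 270 (3 n)^3 steps, which is the dominant part. *)
exists word_problem, (fun n => 150 * 120 * n ^ 3); split; last first.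
  by exists (150 * 120), 0.
move=> [u v]; have [k [m [ex [kc ans]]]] := wp_word_problem u v.
by exists k, m.
Qed.
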